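(* For $\kappa=(\kappa_1,\kappa_2)=(0,0)$, the discrete spectrum $\sigma_{\mathrm{d}}(A^\kappa)$ of the operator $A^\kappa$ is empty.
   Context: For $\kappa=(\kappa_1,\kappa_2)\in\mathbb{R}^2$ set $$\Omega^\kappa:=\{x=(x_1,x_2,x_3)\in\mathbb{R}^3 : x_1>\kappa_1x_3,\ x_2>\kappa_2x_3,\ x_3\in(0,1)\},$$ $\Sigma^\kappa:=\{x\in\partial\Omega^\kappa : x_3=0\text{ or }x_3=1\}$. The lateral faces are $\Gamma_1^\kappa$, the part of $\partial\Omega^\kappa$ where $x_1>\kappa_1x_3$, $x_2=\kappa_2x_3$, $x_3\in(0,1)$, and $\Gamma_2^\kappa$, the part where $x_1=\kappa_1x_3$, $x_2>\kappa_2x_3$, $x_3\in(0,1)$. Let $H^1_0(\Omega^\kappa;\Sigma^\kappa)$ be the space of functions in $H^1(\Omega^\kappa)$ vanishing on $\Sigma^\kappa$. The operator $A^\kappa$ is the Laplacian with Dirichlet condition on $\Sigma^\kappa$ and Neumann condition on $\Gamma_1^\kappa\cup\Gamma_2^\kappa$: it is the positive definite selfadjoint unbounded operator in $L^2(\Omega^\kappa)$ associated with the form $(u,\psi)\mapsto\int_{\Omega^\kappa}\nabla u\cdot\nabla\psi\,dx$ on $H^1_0(\Omega^\kappa;\Sigma^\kappa)$, i.e. $A^\kappa u=-\Delta u$ with domain $\{u\in H^1_0(\Omega^\kappa;\Sigma^\kappa) : \Delta u\in L^2(\Omega^\kappa),\ \partial_\nu u=0\text{ on }\Gamma_1^\kappa\cup\Gamma_2^\kappa\}$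 ($\partial_\nu$ is the outward normal derivative). The discrete spectrum $\sigma_{\mathrm{d}}(A^\kappa)$ is the set of isolated eigenvalues of finite multiplicity, i.e. the complement of the essential spectrum in the spectrum. *)

(* Defs.v *)
From mathcomp Require Import all_boot all_order all_algebra.
From mathcomp Require Import all_classical all_reals all_analysis.
From mathcomp Require Import complex.

Set Implicit Arguments.
Unset Strict Implicit.
Unset Printing Implicit Defensive.

Import Order.TTheory GRing.Theory Num.Theory.
Import numFieldNormedType.Exports.

Local Open Scope classical_set_scope.
Local Open Scope ring_scope.

(* A point x of R^3 is the triple (x_1, x_2, x_3) = ((x_1, x_2), x_3). *)
Notation pt3 R := ((R * R) * R)%type.

Section Domain.
Variable R : realType.
Implicit Type kappa : R * R.

Definition Omega kappa : set (pt3 R) :=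
  [set x | [/\ kappa.1 * x.2 < x.1.1, kappa.2 * x.2 < x.1.2 & 0 < x.2 < 1]].

Definition boundary (T : topologicalType) (D : set T) : set T :=
  closure D `\` interior D.

Definition Sigma kappa : set (pt3 R) :=
  [set x | boundary (Omega kappa) x /\ (x.2 = 0 \/ x.2 = 1)].

End Domain.

Section FunctionSpaces.
Variable R : realType.
Local Notation C := R[i].
Implicit Types (D : set (pt3 R)) (u v f phi : pt3 R -> C).

Definition leb2 := (@lebesgue_measure R \x @lebesgue_measure R)%E.
Definition leb3 := (leb2 \x @lebesgue_measure R)%E.

Definition basis3 (i : 'I_3) : pt3 R :=
  ((i == 0 :> nat)%:R, (i == 1 :> nat)%:R, (i == 2 :> nat)%:R).

Definition partial (i : 'I_3) (h : pt3 R -> R) : pt3 R -> R :=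
  fun x => 'D_(basis3 i) h x.

Definition smooth (h : pt3 R -> R) : Prop :=
  forall s : seq 'I_3, continuous (foldr partial h s) /\
    forall i x, derivable (foldr partial h s) x (basis3 i).

Definition cpartial (i : 'I_3) u : pt3 R -> C :=
  fun x => Complex (partial i (fun y => complex.Re (u y)) x)
                   (partial i (fun y => complex.Im (u y)) x).

Definition test_function D phi : Prop :=
  [/\ smooth (fun x => complex.Re (phi x)), smooth (fun x => complex.Im (phi x)),
      compact (closure [set x | phi x != 0]) &
      closure [set x | phi x != 0] `<=` D].

(* Meaningful when the real and imaginary parts of f are integrable on D,
   which is the case wherever it is used below. *)
Definition cintegral D f : C :=
  Complex (\int[leb3]_(x in D) complex.Re (f x))%R (\int[leb3]_(x in D) complex.Im (f x))%R.

Definition sqnorm D u : \bar R :=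
  (\int[leb3]_(x in D) ((ComplexField.Normc.normc (u x)) ^+ 2)%:E)%E.

(* Elements of L^2(D) are represented by functions on R^3, of which only the
   values on D matter, up to equality almost everywhere on D. *)
Definition L2 D u : Prop :=
  [/\ measurable_fun D (fun x => complex.Re (u x)),
      measurable_fun D (fun x => complex.Im (u x)) & (sqnorm D u < +oo)%E].

Definition ae_eq_on D u v : Prop :=
  u = v %[ae leb3 in D].

(* u belongs to H^1(D) and g is its weak gradient. *)
Definition H1_grad D u (g : 'I_3 -> pt3 R -> C) : Prop :=
  [/\ L2 D u, forall i, L2 D (g i) &
      forall i phi, test_function D phi ->
        cintegral D (fun x => u x * cpartial i phi x) =
        - cintegral D (fun x => g i x * phi x)].

(* Squared norm in L^2(Sigma^kappa): Sigma^kappa lies in the two planes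
   x_3 = 0 and x_3 = 1, on which the surface measure is the two-dimensional
   Lebesgue measure. *)
Definition sqnorm_Sigma (kappa : R * R) v : \bar R :=
  (\int[leb2]_(y in [set y | Sigma kappa (y, 0%R)])
      ((ComplexField.Normc.normc (v (y, 0%R))) ^+ 2)%:E +
   \int[leb2]_(y in [set y | Sigma kappa (y, 1%R)])
      ((ComplexField.Normc.normc (v (y, 1%R))) ^+ 2)%:E)%E.

(* The trace operator is the continuous extension to H^1(Omega^kappa), with
   values in L^2(Sigma^kappa), of the restriction map v |-> v|_Sigma defined on
   C_c^oo(R^3).  Hence u has zero trace iff (u, 0) is in the closure of
   the graph of that map; g is the weak gradient of u. *)
Definition zero_trace (kappa : R * R) u (g : 'I_3 -> pt3 R -> C) : Prop :=
  forall eps : R, 0 < eps -> exists v, [/\ test_function setT v,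
    (sqnorm (Omega kappa) (fun x => (u x - v x)%R) +
      \sum_(i < 3) sqnorm (Omega kappa) (fun x => (g i x - cpartial i v x)%R)
        < eps%:E)%E &
    (sqnorm_Sigma kappa v < eps%:E)%E].

(* u belongs to H^1_0(Omega^kappa; Sigma^kappa) and g is its weak gradient. *)
Definition H10_grad (kappa : R * R) u (g : 'I_3 -> pt3 R -> C) : Prop :=
  H1_grad (Omega kappa) u g /\ zero_trace kappa u g.

(* The graph of the operator A^kappa associated with the Dirichlet form:
   u is in the domain of A^kappa and A^kappa u = f.  The condition that the
   normal derivative of u vanishes on the lateral faces is the natural boundary
   condition encoded in the variational identity.  As L^2 is taken over
   the complex numbers, the form is the sesquilinear one. *)
Definition A_graph (kappa : R * R) u f : Prop :=
  L2 (Omega kappa) f /\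
  exists2 g, H10_grad kappa u g &
    forall psi h, H10_grad kappa psi h ->
      cintegral (Omega kappa) (fun x => \sum_(i < 3) g i x * (h i x)^*%C) =
      cintegral (Omega kappa) (fun x => f x * (psi x)^*%C).

End FunctionSpaces.

Section SpectralTheory.
Variables (R : realType) (D : set (pt3 R)).
Local Notation C := R[i].
(* The graph of an unbounded linear operator in L^2(D). *)
Variable G : (pt3 R -> C) -> (pt3 R -> C) -> Prop.

(* G u (z u + f) says that (A - z) u = f: the operator A - z is injective,
   surjective, and has a bounded inverse. *)
Definition resolvent_set : set C := [set z |
  [/\ forall u, G u (fun x => z * u x) -> ae_eq_on D u (fun=> 0),
      forall f, L2 D f -> exists u, G u (fun x => z * u x + f x) &
      exists M : R, forall u f, L2 D f -> G u (fun x => z * u x + f x) ->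
        (sqnorm D u <= M%:E * sqnorm D f)%E]].

Definition spectrum : set C := ~` resolvent_set.

Definition eigenvector (lambda : C) (u : pt3 R -> C) : Prop :=
  G u (fun x => lambda * u x) /\ ~ ae_eq_on D u (fun=> 0).

Definition is_eigenvalue (lambda : C) : Prop := exists u, eigenvector lambda u.

Definition finite_multiplicity (lambda : C) : Prop :=
  exists n (b : 'I_n -> pt3 R -> C),
    (forall j, G (b j) (fun x => lambda * b j x)) /\
    (forall u, G u (fun x => lambda * u x) ->
      exists c : 'I_n -> C, ae_eq_on D u (fun x => \sum_(j < n) c j * b j x)).

Definition isolated_in_spectrum (lambda : C) : Prop :=
  spectrum lambda /\
  exists2 eps : R, 0 < eps & forall mu, spectrum mu ->
    ComplexField.Normc.normc (mu - lambda) < eps -> mu = lambda.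

Definition discrete_spectrum : set C := [set lambda |
  [/\ is_eigenvalue lambda, isolated_in_spectrum lambda &
      finite_multiplicity lambda]].

End SpectralTheory.

Definition sigma_d (R : realType) (kappa : R * R) : set R[i] :=
  discrete_spectrum (Omega kappa) (A_graph kappa).

(* Main.v *)
From HB Require Import structures.
Require Import Defs.
From mathcomp Require Import all_boot all_order all_algebra.
From mathcomp Require Import all_classical all_reals all_analysis.
From mathcomp Require Import measurable_realfun complex ring lra.

Set Implicit Arguments.
Unset Strict Implicit.
Unset Printing Implicit Defensive.
Import Order.TTheory GRing.Theory Num.Theory.
Import numFieldNormedType.Exports.
Local Open Scope classical_set_scope.
Local Open Scope ring_scope.

(** The operator has no eigenvalue at all: an L^2 solution u of A u = lambda u
    vanishes almost everywhere.  The reason is a virial argument, made possible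
    by the invariance of the domain, the product of a quarter plane and an
    interval, under the dilations S_t (x1, x2, x3) = (t x1, x2, x3), t > 0.

    Let g = (g_0, g_1, g_2) be the weak gradient of u.  Testing the equation
    with u itself shows that lambda is real, unless u = 0.  The function u o S_t
    lies in the form domain, with weak gradient (t g_0, g_1, g_2) o S_t
    ([H10_grad_dilate]), so the equation may be tested with u o S_t and with
    u o S_(1/t).  Put p_i = <g_i, g_i o S_t> and q = <u, u o S_t>.  After a
    change of variables in the second identity, the two read
      t p_0 + p_1 + p_2 = lambda q   and   p_0 / t + p_1 + p_2 = lambda q,
    whence p_0 = 0 for t <> 1 ([ip_dilate_partial0]): the derivative of u in the
    direction x1 is orthogonal to all its dilates.  As dilations are strongly
    continuous in L^2, letting t tend to 1 gives g_0 = 0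
    ([dilation_orthogonal_eq0]).

    A square integrable function whose derivative along x1 vanishes is zero.
    For a test function v, integrating the x1-derivative of
    (1 - exp (- x1)) v^2 over x1 > 0 gives, for every delta > 0,
      int exp (- x1) v^2 <= delta int v^2 + delta^-1 int (d_1 v)^2
    ([weighted_inequality3]); approximating u by test functions, then letting
    delta tend to 0, shows that int exp (- x1) |u|^2 = 0
    ([ae_eq0_of_partial0]).

    The approximations of u and g by test functions and their gradients, which
    both limits need, are part of the definition of the zero trace.  They also
    replace any regularity theory, as only test functions are ever
    differentiated in the classical sense. *)

(** * Linear changes of variables in Lebesgue integrals *)

Section ScaledMeasure.
Context d (T : measurableType d) (R : realType).
Variables (m : {measure set T -> \bar R}) (s : T -> T) (c : {nonneg R}).
Hypothesis ms : measurable_fun [set: T] s.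
Hypothesis scaled : forall A, measurable A -> m (s @^-1` A) = (c%:num%:E * m A)%E.

Lemma ge0_integral_scaled (D : set T) (f : T -> \bar R) :
  measurable D -> measurable_fun D f -> (forall x, D x -> 0 <= f x)%E ->
  (\int[m]_(x in s @^-1` D) f (s x) = c%:num%:E * \int[m]_(x in D) f x)%E.
Proof.
move=> mD mf f0; rewrite -ge0_integral_mscale//.
transitivity (\int[pushforward m s]_(x in D) f x)%E.
  rewrite ge0_integral_pushforward// => x; rewrite inE; exact: f0.
apply: eq_measure_integral => A mA _; exact: scaled.
Qed.

(** Where the difference of the two parts is infinite, both sides agree because a
    positive factor fixes both infinities. *)
Lemma integral_scaled (D : set T) (f : T -> \bar R) : 0 < c%:num ->
  measurable D -> measurable_fun D f ->
  (\int[m]_(x in s @^-1` D) f (s x) = c%:num%:E * \int[m]_(x in D) f x)%E.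
Proof.
move=> c0 mD mf; rewrite integralE [in RHS]integralE.
have -> (X Y : \bar R) : (0 <= X -> 0 <= Y ->
    c%:num%:E * (X - Y) = c%:num%:E * X - c%:num%:E * Y)%E.
  have cy : (c%:num%:E * +oo = +oo :> \bar R)%E by rewrite mulry gtr0_sg// mul1e.
  have cNy : (c%:num%:E * -oo = -oo :> \bar R)%E by rewrite mulrNy gtr0_sg// mul1e.
  move: X Y => [x| |] [y| |]//= _ _; rewrite ?cy ?cNy//.
  by congr (_%:E); rewrite mulrDr mulrN.
- rewrite -(ge0_integral_scaled mD (f:=f^\+%E))// -?(ge0_integral_scaled mD (f:=f^\-%E))//.
  + by congr (_ - _)%E; apply: eq_integral => x _; rewrite !unlock.
  + exact: measurable_funeneg.
  + exact: measurable_funepos.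
- exact: integral_ge0.
- exact: integral_ge0.
Qed.

End ScaledMeasure.

(** The measure of a set is the integral over the first factor of the measures
    of its sections, and the map leaves the second factor alone. *)
Lemma scaled_product d1 d2 (T1 : measurableType d1) (T2 : measurableType d2)
    (R : realType) (m1 : {measure set T1 -> \bar R})
    (m2 : {sigma_finite_measure set T2 -> \bar R}) (s : T1 -> T1)
    (c : {nonneg R}) :
  measurable_fun [set: T1] s ->
  (forall A, measurable A -> m1 (s @^-1` A) = (c%:num%:E * m1 A)%E) ->
  forall A, measurable A ->
    (m1 \x m2)%E ((fun x => (s x.1, x.2)) @^-1` A) = (c%:num%:E * (m1 \x m2) A)%E.
Proof.
move=> ms sc A mA; rewrite /product_measure1 -(ge0_integral_scaled ms sc)//.
exact: measurable_fun_xsection.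
Qed.

Section Dilation.
Variable R : realType.
Implicit Types t : R.

(** By uniqueness of Lebesgue measure it suffices to compare both sides,
    multiplied by t, on intervals. *)
Lemma lebesgue_measure_dilation t (t0 : 0 < t) (A : set (measurableTypeR R)) :
  measurable A ->
  lebesgue_measure ( *%R t @^-1` A) = (t^-1%:E * lebesgue_measure A)%E.
Proof.
move=> mA.
have mt : measurable_fun [set: measurableTypeR R]
    ( *%R t : measurableTypeR R -> measurableTypeR R) by exact: mulrl_measurable.
have t0' : 0 <= t by exact: ltW.
rewrite (_ : lebesgue_measure A = mscale (NngNum t0')
    (pushforward lebesgue_measure ( *%R t : _ -> measurableTypeR R)) A).
  by rewrite /mscale/= /pushforward muleA -EFinM mulVf ?mul1e// gt_eqF.
apply: lebesgue_measure_unique => //= _ [[a b]] _ <-.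
rewrite /mscale /= /pushforward.
rewrite (_ : _ @^-1` _ = [set` `](t^-1 * a), (t^-1 * b)]%R]); last first.
  apply/seteqP; split => x /=; rewrite !in_itv/= !ler_pdivlMl// ?ltr_pdivrMl//.
rewrite !lebesgue_measure_itv/= !lte_fin ltr_pM2l ?invr_gt0//.
case: ifP => _; rewrite ?mule0// -EFinB -EFinM.
by rewrite -mulrBr mulrA divff ?mul1r ?gt_eqF.
Qed.

Definition dilate t (x : pt3 R) : pt3 R := (t * x.1.1, x.1.2, x.2).

Lemma measurable_dilate t : measurable_fun [set: pt3 R] (dilate t).
Proof.
apply/measurable_fun_pairP; split => /=; last exact: measurable_snd.
apply/measurable_fun_pairP; split => /=.
- apply: (measurableT_comp (mulrl_measurable t)) => //.
  exact: (measurableT_comp measurable_fst measurable_fst).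
- exact: (measurableT_comp measurable_snd measurable_fst).
Qed.

Definition dilate2 t (y : R * R) : R * R := (t * y.1, y.2).

Lemma measurable_dilate2 t : measurable_fun [set: R * R] (dilate2 t).
Proof.
apply/measurable_fun_pairP; split => /=; last exact: measurable_snd.
exact: (measurableT_comp (mulrl_measurable t) measurable_fst).
Qed.

Lemma leb2_dilate2 t (t0 : 0 < t) (B : set (R * R)) : measurable B ->
  leb2 (dilate2 t @^-1` B) = (t^-1%:E * leb2 B)%E.
Proof.
have t0' : 0 <= t^-1 by rewrite invr_ge0 ltW.
exact: (@scaled_product _ _ _ _ R lebesgue_measure lebesgue_measure _ (NngNum t0')
    (mulrl_measurable t) (lebesgue_measure_dilation t0) B).
Qed.

Lemma leb3_dilate t (t0 : 0 < t) (A : set (pt3 R)) : measurable A ->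
  leb3 (dilate t @^-1` A) = (t^-1%:E * leb3 A)%E.
Proof.
have t0' : 0 <= t^-1 by rewrite invr_ge0 ltW.
exact: (@scaled_product _ _ _ _ R (@leb2 R) lebesgue_measure _ (NngNum t0')
  (measurable_dilate2 t) (leb2_dilate2 t0) A).
Qed.

End Dilation.

(** * Continuous functions on R^3 are measurable *)

Section ContinuousMeasurable.
Context d (T : measurableType d) (R : realType).

Let grid n (y : R) : R := (Num.floor (y * n.+1%:R))%:~R / n.+1%:R.

Let cvg_grid y : grid n y @[n --> \oo] --> y.
Proof.
apply: (@squeeze_cvgr _ _ _ _ (fun n => y - n.+1%:R^-1) (fun=> y)).
- near=> n; have n0 : 0 < n.+1%:R :> R by [].
  have /andP[fl fu] := floor_itv (y * n.+1%:R).
  rewrite /grid ler_pdivrMr// fl andbT ler_pdivlMr// mulrBl mulVf ?gt_eqF//.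
  by move: fu; rewrite intrD; lra.
- rewrite -[X in _ --> X]subr0; apply: cvgB; first exact: cvg_cst.
  exact: cvg_harmonic.
- exact: cvg_cst.
Unshelve. all: by end_near. Qed.

(** The function is the pointwise limit of the functions obtained by rounding
    the second variable down to a grid of mesh 1 / (n + 1); these are measurable
    because only countably many values of the second variable occur. *)
Lemma caratheodory_measurable (f : T * R -> R) :
  (forall y, measurable_fun [set: T] (fun x => f (x, y))) ->
  (forall x, continuous (fun y => f (x, y))) ->
  measurable_fun [set: T * R] f.
Proof.
move=> mf cf.
apply: (@measurable_fun_cvg _ _ _ _ (fun n x => f (x.1, grid n x.2))); last first.
  move=> [x y] _ /=.
  apply: (@cvg_comp _ _ _ (grid^~ y) (fun z : R => f (x, z)) _ (nbhs (y : R))).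
    exact: cvg_grid.
  exact: cf.
move=> n _ B mB; rewrite setTI.
rewrite (_ : _ @^-1` _ = \bigcup_(k in [set: int])
    (((fun x => f (x, k%:~R / n.+1%:R)) @^-1` B) `*`
     `[k%:~R / n.+1%:R, (k + 1)%:~R / n.+1%:R[)); last first.
  have n0 : 0 < n.+1%:R :> R by [].
  apply/seteqP; split => [[x y] /= Bxy|[x y] [k _] [/= Bxy]].
    exists (Num.floor (y * n.+1%:R)) => //; split => //=.
    by rewrite in_itv/= ler_pdivrMr// ltr_pdivlMr// floor_itv.
  rewrite /grid in_itv/= ler_pdivrMr// ltr_pdivlMr// => kP.
  by rewrite (floor_def kP).
apply: countable_bigcupT_measurable => // k; apply: measurableX => //.
by rewrite -[X in measurable X]setTI; exact: mf.
Qed.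
End ContinuousMeasurable.

Lemma continuous_comp_all (U V W : topologicalType) (f : U -> V) (g : V -> W) :
  continuous f -> continuous g -> continuous (fun x => g (f x)).
Proof. by move=> cf cg x; apply: continuous_comp; [exact: cf|exact: cg]. Qed.

Lemma continuous_pair (U V W : topologicalType) (f : U -> V) (g : U -> W) :
  continuous f -> continuous g -> continuous (fun x => (f x, g x)).
Proof.
move=> cf cg x.
by apply: (@cvg_pair _ _ _ _ (nbhs (f x)) (nbhs (g x))); [exact: cf|exact: cg].
Qed.

Lemma continuous_slice1 (R : realType) (y z : R) : continuous (fun x : R => (x, y, z) : pt3 R).
Proof.
apply: continuous_pair => [|?]; last exact: cvg_cst.
by apply: continuous_pair => ?; [exact: cvg_id|exact: cvg_cst].
Qed.

Lemma continuous_coord1 (R : realType) : continuous (fun x : pt3 R => x.1.1).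
Proof. by move=> x; apply: (@cvg_comp _ _ _ fst fst _ (nbhs x.1)); exact: cvg_fst. Qed.

Lemma continuous_sqr (T : topologicalType) (R : realType) (f : T -> R) :
  continuous f -> continuous (fun x => f x ^+ 2).
Proof.
move=> cf; under eq_fun do rewrite expr2.
by move=> x; apply: cvgM; exact: cf.
Qed.

Lemma continuous_dilate (R : realType) (t : R) : continuous (dilate t).
Proof.
apply: continuous_pair => [|x]; last exact: cvg_snd.
apply: continuous_pair => [x|x].
  by apply: cvgMr; exact: continuous_coord1.
exact: (@cvg_comp _ _ _ fst snd _ (nbhs x.1) _ cvg_fst cvg_snd).
Qed.

(** Measurability refers to the product sigma-algebra, so it is obtained one variable
    at a time. *)
Lemma continuous_measurable3 (R : realType) (f : pt3 R -> R) :
  continuous f -> measurable_fun [set: pt3 R] f.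
Proof.
move=> cf; apply: caratheodory_measurable => [z|[x y]].
  apply: (@caratheodory_measurable _ _ _ (fun p => f (p, z))) => [y|x].
    apply: continuous_measurable_fun.
    exact: (continuous_comp_all (@continuous_slice1 R y z) cf).
  apply: continuous_comp_all cf.
  apply: continuous_pair => [|?]; last exact: cvg_cst.
  by apply: continuous_pair => ?; [exact: cvg_cst|exact: cvg_id].
apply: continuous_comp_all cf.
by apply: continuous_pair => ?; [exact: cvg_cst|exact: cvg_id].
Qed.

(** * Partial derivatives of dilated functions *)

Section DirectionalDerivative.
Variables (R : realType) (V W : normedModType R).

Let cvg_dnbhs0M (c : R) : c != 0 -> (h * c) @[h --> (0 : R)^'] --> (0 : R)^'.
Proof.
move=> c0 P [e /= e0 eP]; exists (e / `|c|); first by rewrite /= divr_gt0// normr_gt0.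
move=> h /=; rewrite sub0r normrN => he h0; apply: eP.
  by rewrite /= sub0r normrN normrM -ltr_pdivlMr// normr_gt0.
by rewrite mulf_neq0.
Qed.

Lemma is_derive_scaled (f : V -> W) (x v : V) (c : R) : c != 0 -> derivable f x v ->
  is_derive x (c *: v) f (c *: 'D_v f x).
Proof.
move=> c0 dfv; suff H : h^-1 *: ((f \o shift x) (h *: (c *: v)) - f x) @[h --> 0^']
    --> c *: 'D_v f x.
  by split; [apply/cvg_ex; eexists; exact: H|exact: cvg_lim].
rewrite (_ : (fun h : R => _) = (fun h => c *:
    ((fun k => k^-1 *: ((f \o shift x) (k *: v) - f x)) (h * c)))).
  apply: cvgZr; apply: (@cvg_comp _ _ _ (fun h : R => h * c)
    (fun k => k^-1 *: ((f \o shift x) (k *: v) - f x)) _ ((0 : R)^')).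
    exact: cvg_dnbhs0M.
  exact: dfv.
apply/funext => h /=; rewrite scalerA [in RHS]scalerA invfM [h^-1 * c^-1]mulrC.
by rewrite mulrA divff// mul1r.
Qed.
End DirectionalDerivative.

Section DilatedDerivative.
Variables (R : realType) (t : R).
Hypothesis t0 : 0 < t.

(** The i-th diagonal entry of the linear map [dilate t]. *)
Definition dil_factor (i : 'I_3) : R := if i == 0 :> nat then t else 1.

Lemma dil_factor_neq0 i : dil_factor i != 0.
Proof. by rewrite /dil_factor; case: ifP => _; rewrite ?oner_neq0// gt_eqF. Qed.

Let dilate_basis3 i : dilate t (basis3 R i) = dil_factor i *: basis3 R i.
Proof.
rewrite /dilate /basis3 /dil_factor; case: i => -[|[|[|//]]] i3 /=;
  by congr (_, _, _) => /=; rewrite /GRing.scale/= ?(mulr0, mulr1, mul1r).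
Qed.

Let dilate_linear (k : R) (v x : pt3 R) :
  dilate t (k *: v + x) = k *: dilate t v + dilate t x.
Proof.
by rewrite /dilate/=; congr (_, _, _) => /=; rewrite /GRing.scale/= mulrDr mulrCA.
Qed.

Lemma partial_dilate i (h : pt3 R -> R) x : derivable h (dilate t x) (basis3 R i) ->
  derivable (h \o dilate t) x (basis3 R i) /\
  partial i (h \o dilate t) x = dil_factor i * partial i h (dilate t x).
Proof.
move=> dh; have [] := is_derive_scaled (dil_factor_neq0 i) dh.
rewrite -dilate_basis3 /derivable /partial /derive.
rewrite (_ : (fun k : R => _) = (fun k : R => k^-1 *:
    ((h \o dilate t \o shift x) (k *: basis3 R i) - (h \o dilate t) x))) //.
by apply/funext => k /=; rewrite dilate_linear.
Qed.

(** Each iterated partial derivative of the dilated function is a power of t times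
    the dilated iterated partial derivative. *)
Lemma smooth_dilate (h : pt3 R -> R) : smooth h -> smooth (h \o dilate t).
Proof.
move=> sh.
have E (s : seq 'I_3) : foldr (@partial R) (h \o dilate t) s =
    (fun x => (\prod_(i <- s) dil_factor i) * foldr (@partial R) h s (dilate t x)).
  elim: s => [|i s IH] /=; first by rewrite big_nil; apply/funext => x; rewrite mul1r.
  rewrite IH big_cons; apply/funext => x.
  set F := foldr _ _ _; set c := \prod_(_ <- _) _.
  have [d e] := @partial_dilate i F x ((sh s).2 _ _).
  rewrite -mulrA mulrCA -e /partial.
  exact: (deriveZ c d).
move=> s; have [cs ds] := sh s; rewrite E; split.
  apply: (@continuous_comp_all _ _ _ (dilate t)
    (fun y => _ * foldr (@partial R) h s y)); first exact: continuous_dilate.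
  by move=> x; apply: cvgMr; exact: cs.
move=> i x; set F := foldr _ _ _; set c := \prod_(_ <- _) _.
have [d e] := @partial_dilate i F x (ds _ _).
exact: (@derivableZ _ _ _ _ c _ _ d).
Qed.

End DilatedDerivative.

(** * Dilations act on the domain and on test functions *)

Section Domain.
Variable R : realType.
Local Notation C := R[i].
Local Notation Om := (Omega ((0 : R), (0 : R))).

Lemma OmegaE : Om = (`]0, +oo[%classic `*` `]0, +oo[%classic) `*` `]0, 1[%classic.
Proof.
apply/seteqP; split => [[[x y] z]|[[x y] z]] /=; rewrite /Omega/= !mul0r !in_itv/= !andbT.
  by case.
by move=> [[]].
Qed.

Lemma measurable_Omega : measurable Om.
Proof.
by rewrite OmegaE; apply: measurableX; [apply: measurableX|]; exact: measurable_itv.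
Qed.

Section Dilated.
Variable t : R.
Hypothesis t0 : 0 < t.

Lemma preimage_dilate_Omega : dilate t @^-1` Om = Om.
Proof.
by apply/seteqP; split => x; rewrite /Omega/= !mul0r pmulr_rgt0.
Qed.

Lemma dilateK : cancel (dilate t) (dilate t^-1).
Proof. by move=> [[x y] z]; rewrite /dilate/= mulKf// gt_eqF. Qed.

Lemma dilateVK : cancel (dilate t^-1) (dilate t).
Proof. by move=> [[x y] z]; rewrite /dilate/= mulVKf// gt_eqF. Qed.

(** The support of the dilated function is the image of the original support under
    the inverse dilation, hence compact. *)
Lemma test_function_dilate D (phi : pt3 R -> C) : test_function D phi ->
  test_function (dilate t @^-1` D) (phi \o dilate t).
Proof.
move=> [sR sI cpt sub].
pose K := dilate t^-1 @` closure [set x | phi x != 0].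
have cK : compact K.
  by apply: continuous_compact => //; apply: continuous_subspaceT; exact: continuous_dilate.
have sK : closure [set x | (phi \o dilate t) x != 0] `<=` K.
  have clK : closed K by apply: compact_closed => //; exact: norm_hausdorff.
  rewrite [X in _ `<=` X]((closure_id K).1 clK); apply: closure_subset => x /= px.
  exists (dilate t x); last exact: dilateK.
  exact: subset_closure.
split.
- exact: (smooth_dilate t0 sR).
- exact: (smooth_dilate t0 sI).
- by apply: subclosed_compact cK sK; exact: closed_closure.
- by move=> x /sK [y /sub Dy <-] /=; rewrite dilateVK.
Qed.

Lemma cpartial_dilate D i (phi : pt3 R -> C) x : test_function D phi ->
  cpartial i (phi \o dilate t) x = Complex (dil_factor t i) 0 * cpartial i phi (dilate t x).
Proof.
move=> [sR sI _ _]; rewrite /cpartial/=.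
have [_ eR] := @partial_dilate R t t0 i _ x ((sR [::]).2 i (dilate t x)).
have [_ eI] := @partial_dilate R t t0 i _ x ((sI [::]).2 i (dilate t x)).
by apply/eqP; rewrite eq_complex/= !mul0r subr0 addr0 -eR -eI !eqxx.
Qed.

End Dilated.
End Domain.

(** * Norms and traces under dilations *)

Section SqNorm.
Variable R : realType.
Local Notation C := R[i].
Local Notation Om := (Omega ((0 : R), (0 : R))).
Implicit Types (u v : pt3 R -> C).

Definition sqmod (z : C) : R := complex.Re z ^+ 2 + complex.Im z ^+ 2.

Lemma sqmod_ge0 z : 0 <= sqmod z.
Proof. by rewrite addr_ge0// sqr_ge0. Qed.

Lemma sqr_normc z : ComplexField.Normc.normc z ^+ 2 = sqmod z.
Proof. by case: z => a b /=; rewrite sqr_sqrtr// addr_ge0// sqr_ge0. Qed.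

Lemma sqnormE D u : sqnorm D u = (\int[@leb3 R]_(x in D) (sqmod (u x))%:E)%E.
Proof. by apply: eq_integral => x _; rewrite sqr_normc. Qed.

Definition cmeasurable d (T : measurableType d) (D : set T) (w : T -> C) :=
  measurable_fun D (fun x => complex.Re (w x)) /\
  measurable_fun D (fun x => complex.Im (w x)).

Lemma measurable_sqmod d (T : measurableType d) (D : set T) (w : T -> C) :
  measurable D -> cmeasurable D w -> measurable_fun D (fun x => (sqmod (w x))%:E).
Proof.
move=> mD [mR mI]; apply/measurable_EFinP.
by apply: measurable_funD; exact: measurable_funX.
Qed.

Section Dilated.
Variable t : R.
Hypothesis t0 : 0 < t.

Let tV0 : 0 <= t^-1. Proof. by rewrite invr_ge0 ltW. Qed.

Lemma measurable_comp_dilate d' (T' : measurableType d') (f : pt3 R -> T') :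
  measurable_fun Om f -> measurable_fun Om (f \o dilate t).
Proof.
move=> mf; apply: (@measurable_comp _ _ _ _ _ _ Om f Om (dilate t)) => //.
- exact: measurable_Omega.
- by move=> _ [x Ox <-]; rewrite -(preimage_dilate_Omega t0) in Ox.
- by apply: measurable_funS (measurable_dilate t).
Qed.

Lemma ge0_integral_dilate (f : pt3 R -> \bar R) :
  measurable_fun Om f -> (forall x, Om x -> 0 <= f x)%E ->
  (\int[@leb3 R]_(x in Om) f (dilate t x) = t^-1%:E * \int[@leb3 R]_(x in Om) f x)%E.
Proof.
move=> mf f0.
have := @ge0_integral_scaled _ _ _ (@leb3 R) (dilate t) (NngNum tV0)
  (measurable_dilate t) (leb3_dilate t0) Om f (@measurable_Omega R) mf f0.
by rewrite preimage_dilate_Omega.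
Qed.

Lemma integral_dilate (f : pt3 R -> \bar R) : measurable_fun Om f ->
  (\int[@leb3 R]_(x in Om) f (dilate t x) = t^-1%:E * \int[@leb3 R]_(x in Om) f x)%E.
Proof.
move=> mf; have tV : 0 < (NngNum tV0)%:num by rewrite /= invr_gt0.
have := @integral_scaled _ _ _ (@leb3 R) (dilate t) (NngNum tV0)
  (measurable_dilate t) (leb3_dilate t0) Om f tV (@measurable_Omega R) mf.
by rewrite preimage_dilate_Omega.
Qed.

Lemma Rintegral_dilate (f : pt3 R -> R) : measurable_fun Om f ->
  (\int[@leb3 R]_(x in Om) f (dilate t x) = t^-1 * \int[@leb3 R]_(x in Om) f x)%R.
Proof.
move=> mf; rewrite /Rintegral (integral_dilate (f:=EFin \o f)).
  have tVgt0 : 0 < t^-1 by rewrite invr_gt0.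
  case: (\int[_]_(_ in _) _)%E => [r //| |].
    by rewrite mulry gtr0_sg// mul1e /= mulr0.
  by rewrite mulrNy gtr0_sg// mul1e /= mulr0.
exact/measurable_EFinP.
Qed.

Lemma sqnorm_dilate u : cmeasurable Om u ->
  sqnorm Om (u \o dilate t) = (t^-1%:E * sqnorm Om u)%E.
Proof.
move=> mu; rewrite !sqnormE -ge0_integral_dilate//.
  exact: measurable_sqmod (@measurable_Omega R) mu.
by move=> x _; rewrite lee_fin sqmod_ge0.
Qed.

Lemma L2_dilate u : L2 Om u -> L2 Om (u \o dilate t).
Proof.
move=> [mR mI uoo]; split; [exact: (measurable_comp_dilate mR)|exact: (measurable_comp_dilate mI)|].
by rewrite sqnorm_dilate// lte_mul_pinfty// lee_fin.
Qed.
End Dilated.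

Lemma Re_scale (c : R) z : complex.Re (Complex c 0 * z) = c * complex.Re z.
Proof. by case: z => a b /=; rewrite mul0r subr0. Qed.

Lemma Im_scale (c : R) z : complex.Im (Complex c 0 * z) = c * complex.Im z.
Proof. by case: z => a b /=; rewrite mul0r addr0. Qed.

Lemma sqmod_scale (c : R) z : sqmod (Complex c 0 * z) = c ^+ 2 * sqmod z.
Proof. by rewrite /sqmod Re_scale Im_scale !exprMn mulrDr. Qed.

Lemma sqnorm_scale D (c : R) u : measurable D -> cmeasurable D u ->
  sqnorm D (fun x => Complex c 0 * u x) = ((c ^+ 2)%:E * sqnorm D u)%E.
Proof.
move=> mD mu; rewrite !sqnormE -ge0_integralZl_EFin ?sqr_ge0//.
- by apply: eq_integral => x _; rewrite sqmod_scale EFinM.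
- by move=> x _; rewrite lee_fin sqmod_ge0.
- exact: measurable_sqmod.
Qed.

Lemma cmeasurable_scale d (T : measurableType d) D (c : R) (w : T -> C) :
  cmeasurable D w -> cmeasurable D (fun x => Complex c 0 * w x).
Proof.
move=> [mR mI]; split.
- by under eq_fun do rewrite Re_scale; exact: measurable_funM.
- by under eq_fun do rewrite Im_scale; exact: measurable_funM.
Qed.

Lemma L2_scale D (c : R) u : measurable D -> L2 D u -> L2 D (fun x => Complex c 0 * u x).
Proof.
move=> mD [mR mI uoo]; have mu : cmeasurable D u by [].
have [? ?] := cmeasurable_scale c mu; split => //.
by rewrite sqnorm_scale// lte_mul_pinfty// lee_fin sqr_ge0.
Qed.

End SqNorm.

Section SigmaSlices.
Variable R : realType.
Local Notation Om := (Omega ((0 : R), (0 : R))).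
Local Notation k0 := ((0 : R)%R, (0 : R)%R).
Local Notation Sg := (Sigma k0).

(** A boundary point is approached along a segment that enters the domain; the
    last coordinate moves upwards from 0 or downwards from 1. *)
Lemma closure_Omega (x y z : R) :
  0 <= x -> 0 <= y -> z = 0 \/ z = 1 -> closure Om (x, y, z).
Proof.
move=> x0 y0 z01 B Bx.
pose g (e : R) : pt3 R := (x + 1 * e, y + 1 * e, z + (1 - 2 * z) * e).
have cl (a b : R) : continuous (fun e : R => a + b * e).
  by move=> e; apply: (@cvgD _ _ _ _ _ (fun=> a)); [exact: cvg_cst|exact: mulrl_continuous].
have cg : continuous g.
  by apply: continuous_pair; [apply: continuous_pair|]; exact: cl.
have Bg : nbhs (g 0) B by rewrite /g !mulr0 !addr0.
have /nbhs_ballP[d /= d0 dB] := cg 0 B Bg.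
pose e := Num.min d 1 / 2.
have e0 : 0 < e by rewrite divr_gt0// lt_min d0 ltr01.
have ed : e < d by rewrite ltr_pdivrMr// gt_min ltr_pMr// ltr1n.
have e1 : e < 1 by rewrite ltr_pdivrMr// gt_min mul1r ltr1n orbT.
exists (g e); split.
  rewrite /Omega/= !mul0r !mul1r; split; [lra|lra|].
  by case: z01 => ->; apply/andP; split; lra.
by apply: dB; rewrite /ball/= sub0r normrN gtr0_norm.
Qed.

(** The two horizontal faces are closed quarter planes.  What matters below is that
    they are measurable and invariant under dilations. *)
Lemma Sigma_slice z : z = 0 \/ z = 1 ->
  [set y : R * R | Sg (y, z)] = `[0, +oo[%classic `*` `[0, +oo[%classic.
Proof.
move=> z01; apply/seteqP; split => [[x y]|[x y]] /=; rewrite /Sigma/= !in_itv/= !andbT.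
  move=> [[cl _] _].
  pose H : set (pt3 R) := fst @^-1` (fst @^-1` [set r | 0 <= r] `&` snd @^-1` [set r | 0 <= r]).
  suff : H (x, y, z) by [].
  have cH : closed H.
    apply: closed_comp; first by move=> p _; exact: cvg_fst.
    apply: closedI; apply: closed_comp; try exact: closed_ge.
    - by move=> p _; exact: cvg_fst.
    - by move=> p _; exact: cvg_snd.
  rewrite ((closure_id H).1 cH); apply: closure_subset cl => -[[a b] c] [/=].
  by rewrite !mul0r => /ltW a0 /ltW b0 _.
move=> [x0 y0]; split => //; split; first exact: closure_Omega.
move=> /interior_subset[_ _] /=.
by case: z01 => ->; rewrite ltxx// andbF.
Qed.

Lemma sqnorm_Sigma_dilate (t : R) (v : pt3 R -> R[i]) : 0 < t ->
  continuous (fun x => complex.Re (v x)) -> continuous (fun x => complex.Im (v x)) ->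
  sqnorm_Sigma k0 (v \o dilate t) =
  (t^-1%:E * sqnorm_Sigma k0 v)%E.
Proof.
move=> t0 cR cI; rewrite /sqnorm_Sigma !Sigma_slice; [|by right|by left].
set D := _ `*` _.
have mD : measurable D by apply: measurableX; exact: measurable_itv.
have tV0 : 0 <= t^-1 by rewrite invr_ge0 ltW.
have D_dil : dilate2 t @^-1` D = D.
  by apply/seteqP; split => -[x y]; rewrite /D/= !in_itv/= !andbT pmulr_rge0.
have slice (z : R) : (\int[@leb2 R]_(y in D) (sqmod ((v \o dilate t) (y, z)))%:E =
    t^-1%:E * \int[@leb2 R]_(y in D) (sqmod (v (y, z)))%:E)%E.
  have mv : measurable_fun D (fun y => (sqmod (v (y, z)))%:E).
    apply: measurable_sqmod => //; split; apply: measurable_funTS.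
      exact: (@measurable_fun_pair1 _ _ _ _ _ _ (fun x => complex.Re (v x)) z
        (continuous_measurable3 cR)).
    exact: (@measurable_fun_pair1 _ _ _ _ _ _ (fun x => complex.Im (v x)) z
      (continuous_measurable3 cI)).
  have sq0 y : D y -> (0 <= (sqmod (v (y, z)))%:E)%E by rewrite lee_fin sqmod_ge0.
  have := @ge0_integral_scaled _ _ _ (@leb2 R) (dilate2 t) (NngNum tV0)
    (measurable_dilate2 t) (leb2_dilate2 t0) D _ mD mv sq0.
  by rewrite D_dil.
under eq_integral do rewrite sqr_normc.
under [X in (_ + X)%E]eq_integral do rewrite sqr_normc.
under [in RHS]eq_integral do rewrite sqr_normc.
under [X in (_ * (_ + X))%E]eq_integral do rewrite sqr_normc.
rewrite !slice [RHS]ge0_muleDr//; apply: integral_ge0 => y _; exact: sqmod_ge0.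
Qed.
End SigmaSlices.

(** * Continuous functions with compact support *)

Section CompactSupport.
Variable R : realType.
Local Notation C := R[i].
Local Notation leb3 := (@leb3 R).
Implicit Types (f h : pt3 R -> R) (K D : set (pt3 R)).

Definition vanishes_off K f := forall x, ~ K x -> f x = 0.

Lemma continuous_bounded_on_compact K f : compact K -> continuous f -> vanishes_off K f ->
  exists2 M, 0 <= M & forall x, `|f x| <= M.
Proof.
move=> cK cf fK.
have : compact (f @` K).
  by apply: continuous_compact => //; exact: continuous_subspaceT.
move=> /compact_bounded[N [_ hN]].
have N1 : N < `|N| + 1 by rewrite ltr_pwDr// ler_norm.
exists (`|N| + 1) => [|x]; first by rewrite addr_ge0.
have [Kx|nKx] := pselect (K x); last by rewrite fK// normr0 addr_ge0.
by apply: (hN _ N1); exists x.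
Qed.

Definition box (L : R) : set (pt3 R) :=
  (`[-L, L]%classic `*` `[-L, L]%classic) `*` `[-L, L]%classic.

Lemma measurable_box L : measurable (box L).
Proof. by apply: measurableX; [apply: measurableX|]; exact: measurable_itv. Qed.

Lemma leb3_box L : (leb3 (box L) < +oo)%E.
Proof.
have LE : (lebesgue_measure `[(- L)%R, L]%classic \is a fin_num)%E.
  by rewrite lebesgue_measure_itv/=; case: ifP.
rewrite /Defs.leb3 /box product_measure1E; [|apply: measurableX|]; try exact: measurable_itv.
rewrite [X in (X * _)%E]product_measure1E; try exact: measurable_itv.
by rewrite ltey_eq !fin_numM.
Qed.

Lemma compact_sub_box K : compact K -> exists2 L, 0 <= L & K `<=` box L.
Proof.
move=> /compact_bounded[N [_ hN]].
have N1 : N < `|N| + 1 by rewrite ltr_pwDr// ler_norm.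
exists (`|N| + 1) => [|[[x y] z] Kx]; first by rewrite addr_ge0.
have : Num.max (Num.max `|x| `|y|) `|z| <= `|N| + 1 by exact: (hN _ N1 _ Kx).
rewrite !ge_max => /andP[/andP[xN yN] zN].
by rewrite /box/=!in_itv/= -!ler_norml.
Qed.

Lemma compactly_supported_bound K f : compact K -> continuous f -> vanishes_off K f ->
  exists M L, [/\ 0 <= M, 0 <= L & forall x, `|f x| <= M * \1_(box L) x].
Proof.
move=> cK cf fK; have [M M0 fM] := continuous_bounded_on_compact cK cf fK.
have [L L0 KL] := compact_sub_box cK.
exists M, L; split => // x; rewrite indicE.
have [Kx|nKx] := pselect (K x); first by rewrite mem_set ?mulr1//; exact: KL.
by rewrite fK// normr0 mulr_ge0.
Qed.

Lemma integrable_box D M L : measurable D ->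
  leb3.-integrable D (fun x => (M * \1_(box L) x)%:E).
Proof.
move=> mD.
have mb : measurable_fun D (fun x => (\1_(box L) x : R)).
  by apply: measurable_funTS; exact: measurable_indic (measurable_box L).
under eq_fun do rewrite EFinM; apply: integrableZl => //.
apply/integrableP; split; first exact/measurable_EFinP.
under eq_integral do rewrite gee0_abs ?lee_fin//.
rewrite integral_indic//; last exact: measurable_box.
apply: le_lt_trans (leb3_box L); apply: le_measure; rewrite ?inE.
- by apply: measurableI => //; exact: measurable_box.
- exact: measurable_box.
- exact: subIsetl.
Qed.

(** Such a function is bounded by a multiple of the indicator of a box. *)
Lemma integrable_compactly_supported K D f : measurable D -> compact K -> continuous f ->
  vanishes_off K f -> leb3.-integrable D (EFin \o f).
Proof.
move=> mD cK cf fK; have [M [L [M0 L0 fM]]] := compactly_supported_bound cK cf fK.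
apply: (@le_integrable _ _ _ leb3 D mD (EFin \o f) 
  (fun x => (M * \1_(box L) x)%:E)); last exact: integrable_box.
  by apply/measurable_EFinP; apply: measurable_funTS; exact: continuous_measurable3.
move=> x _; rewrite /= lee_fin; apply: le_trans (fM x) _; exact: ler_norm.
Qed.

Lemma vanishes_off_partial K i f : closed K -> vanishes_off K f -> vanishes_off K (partial i f).
Proof.
move=> cK fK x nKx; rewrite /partial.
rewrite (@near_eq_derive _ _ _ f (cst 0) x) ?derive_cst//.
have : nbhs x (~` K) by apply: open_nbhs_nbhs; split => //; exact: closed_openC.
by apply: filterS => y nKy; rewrite fK.
Qed.

Lemma test_function_support D (phi : pt3 R -> C) : test_function D phi ->
  exists K, [/\ compact K, K `<=` D, vanishes_off K (fun x => complex.Re (phi x)),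
    vanishes_off K (fun x => complex.Im (phi x)) &
    forall i, vanishes_off K (fun x => complex.Re (cpartial i phi x)) /\
              vanishes_off K (fun x => complex.Im (cpartial i phi x))].
Proof.
move=> [_ _ cK KD]; set K := closure _ in cK KD.
have phiK x : ~ K x -> phi x = 0.
  by move=> nKx; apply/eqP; apply: contra_notT nKx => px; exact: subset_closure.
have vR : vanishes_off K (fun x => complex.Re (phi x)) by move=> x /phiK ->.
have vI : vanishes_off K (fun x => complex.Im (phi x)) by move=> x /phiK ->.
exists K; split => // i.
by split; apply: vanishes_off_partial => //; exact: closed_closure.
Qed.

Lemma test_function_continuous D (phi : pt3 R -> C) : test_function D phi ->
  [/\ continuous (fun x => complex.Re (phi x)), continuous (fun x => complex.Im (phi x)),
    forall i, continuous (fun x => complex.Re (cpartial i phi x)) &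
    forall i, continuous (fun x => complex.Im (cpartial i phi x))].
Proof.
move=> [sR sI _ _]; split.
- exact: (sR [::]).1.
- exact: (sI [::]).1.
- by move=> i; exact: (sR [:: i]).1.
- by move=> i; exact: (sI [:: i]).1.
Qed.

Lemma L2_compactly_supported K D (w : pt3 R -> C) : measurable D -> compact K ->
  continuous (fun x => complex.Re (w x)) -> continuous (fun x => complex.Im (w x)) ->
  vanishes_off K (fun x => complex.Re (w x)) ->
  vanishes_off K (fun x => complex.Im (w x)) -> L2 D w.
Proof.
move=> mD cK cR cI vR vI; split.
- by apply: measurable_funTS; exact: continuous_measurable3.
- by apply: measurable_funTS; exact: continuous_measurable3.
- rewrite sqnormE; have : leb3.-integrable D (EFin \o (fun x => sqmod (w x))).
    apply: (integrable_compactly_supported mD cK).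
      move=> x; apply: cvgD.
        by rewrite expr2; under eq_fun do rewrite expr2; apply: cvgM; exact: cR.
      by rewrite expr2; under eq_fun do rewrite expr2; apply: cvgM; exact: cI.
    by move=> x nKx; rewrite /sqmod vR// vI// expr0n addr0.
  exact: integrable_lty.
Qed.
End CompactSupport.

(** * Products of square integrable functions *)

Section Pairing.
Variable R : realType.
Local Notation C := R[i].
Local Notation leb3 := (@leb3 R).
Variable D : set (pt3 R).
Hypothesis mD : measurable D.
Implicit Types (u v w : pt3 R -> C) (F : pt3 R -> R).

Lemma integrable_sqmod u : L2 D u -> leb3.-integrable D (fun x => (sqmod (u x))%:E).
Proof.
move=> [mR mI uoo]; have mu : cmeasurable D u by [].
apply/integrableP; split; first exact: measurable_sqmod.
by under eq_integral do rewrite gee0_abs ?lee_fin ?sqmod_ge0//; rewrite -sqnormE.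
Qed.

Lemma integrable_pairing u v F : L2 D u -> L2 D v -> measurable_fun D F ->
  (forall x, D x -> `|F x| <= sqmod (u x) + sqmod (v x)) ->
  leb3.-integrable D (EFin \o F).
Proof.
move=> Lu Lv mF Fle.
apply: (@le_integrable _ _ _ leb3 D mD _
  (fun x => (sqmod (u x))%:E + (sqmod (v x))%:E)%E).
- exact/measurable_EFinP.
- move=> x Dx; rewrite /= lee_fin; apply: le_trans (Fle x Dx) _; exact: ler_norm.
- by apply: integrableD => //; exact: integrable_sqmod.
Qed.

Lemma Re_mul (z w : C) : complex.Re (z * w) =
  complex.Re z * complex.Re w - complex.Im z * complex.Im w.
Proof. by case: z w => [a b] [c d]. Qed.

Lemma Im_mul (z w : C) : complex.Im (z * w) =
  complex.Re z * complex.Im w + complex.Im z * complex.Re w.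
Proof. by case: z w => [a b] [c d]. Qed.

Lemma normr_Re_mul_le (z w : C) : `|complex.Re (z * w)| <= sqmod z + sqmod w.
Proof.
rewrite Re_mul /sqmod; case: z w => [a b] [c d] /=.
have := sqr_ge0 (a + c); have := sqr_ge0 (a - c).
have := sqr_ge0 (b + d); have := sqr_ge0 (b - d).
by rewrite ler_norml => ? ? ? ?; apply/andP; split; nra.
Qed.

Lemma normr_Im_mul_le (z w : C) : `|complex.Im (z * w)| <= sqmod z + sqmod w.
Proof.
rewrite Im_mul /sqmod; case: z w => [a b] [c d] /=.
have := sqr_ge0 (a + d); have := sqr_ge0 (a - d).
have := sqr_ge0 (b + c); have := sqr_ge0 (b - c).
by rewrite ler_norml => ? ? ? ?; apply/andP; split; nra.
Qed.

Lemma cmeasurable_mul u v : cmeasurable D u -> cmeasurable D v ->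
  cmeasurable D (fun x => u x * v x).
Proof.
move=> [uR uI] [vR vI]; split.
- under eq_fun do rewrite Re_mul.
  by apply: measurable_funB; exact: measurable_funM.
- under eq_fun do rewrite Im_mul.
  by apply: measurable_funD; exact: measurable_funM.
Qed.

Lemma Re_sub (z w : C) : complex.Re (z - w) = complex.Re z - complex.Re w.
Proof. by case: z w => [a b] [c d]. Qed.

Lemma Im_sub (z w : C) : complex.Im (z - w) = complex.Im z - complex.Im w.
Proof. by case: z w => [a b] [c d]. Qed.

Lemma cmeasurable_sub u v : cmeasurable D u -> cmeasurable D v ->
  cmeasurable D (fun x => u x - v x).
Proof.
move=> [uR uI] [vR vI]; split.
- by under eq_fun do rewrite Re_sub; exact: measurable_funB.
- by under eq_fun do rewrite Im_sub; exact: measurable_funB.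
Qed.

Lemma L2_cmeasurable u : L2 D u -> cmeasurable D u.
Proof. by case. Qed.

Lemma integrable_Re_mul u v : L2 D u -> L2 D v ->
  leb3.-integrable D (fun x => (complex.Re (u x * v x))%:E).
Proof.
move=> Lu Lv; apply: (integrable_pairing Lu Lv) => [|x _]; last exact: normr_Re_mul_le.
by have [] := cmeasurable_mul (L2_cmeasurable Lu) (L2_cmeasurable Lv).
Qed.

Lemma integrable_Im_mul u v : L2 D u -> L2 D v ->
  leb3.-integrable D (fun x => (complex.Im (u x * v x))%:E).
Proof.
move=> Lu Lv; apply: (integrable_pairing Lu Lv) => [|x _]; last exact: normr_Im_mul_le.
by have [] := cmeasurable_mul (L2_cmeasurable Lu) (L2_cmeasurable Lv).
Qed.

Lemma cintegral_scale (c : R) u v : L2 D u -> L2 D v ->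
  cintegral D (fun x => Complex c 0 * (u x * v x)) =
  Complex c 0 * cintegral D (fun x => u x * v x).
Proof.
move=> Lu Lv; apply/eqP; rewrite eq_complex Re_scale Im_scale /=; apply/andP; split.
- under eq_Rintegral do rewrite Re_scale.
  by rewrite RintegralZl//; exact: integrable_Re_mul.
- under eq_Rintegral do rewrite Im_scale.
  by rewrite RintegralZl//; exact: integrable_Im_mul.
Qed.
End Pairing.

(** * Dilations act on the form domain *)

Section DilatedH10.
Variables (R : realType) (t : R).
Hypothesis t0 : 0 < t.
Local Notation C := R[i].
Local Notation k0 := ((0 : R)%R, (0 : R)%R).
Local Notation Om := (Omega k0).
Implicit Types (u : pt3 R -> C) (g : 'I_3 -> pt3 R -> C).

Definition dilate_grad g : 'I_3 -> pt3 R -> C :=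
  fun i x => Complex (dil_factor t i) 0 * g i (dilate t x).

Lemma cintegral_dilate (F : pt3 R -> C) : cmeasurable Om F ->
  cintegral Om (fun x => F (dilate t x)) = Complex t^-1 0 * cintegral Om F.
Proof.
move=> [mR mI]; apply/eqP; rewrite eq_complex Re_scale Im_scale /cintegral/=.
by rewrite (Rintegral_dilate t0 mR) (Rintegral_dilate t0 mI) !eqxx.
Qed.

Lemma test_function_L2 D (phi : pt3 R -> C) : test_function D phi ->
  L2 Om phi /\ forall i, L2 Om (cpartial i phi).
Proof.
move=> tphi; have [K [cK _ vR vI vP]] := test_function_support tphi.
have [cR cI cPR cPI] := test_function_continuous tphi.
split=> [|i]; first exact: (L2_compactly_supported (@measurable_Omega R) cK).
by apply: (L2_compactly_supported (@measurable_Omega R) cK) => //; case: (vP i).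
Qed.

(** A test function phi on the domain is psi o S_t for another one, psi; the identity
    for phi is the identity for (u, psi), after a change of variables, up to the
    common factor t^-1 times the i-th entry of S_t. *)
Lemma H1_grad_dilate u g : H1_grad Om u g -> H1_grad Om (u \o dilate t) (dilate_grad g).
Proof.
move=> [Lu Lg ibp]; split.
- exact: L2_dilate.
- by move=> i; apply: L2_scale; [exact: measurable_Omega|exact: (L2_dilate t0 (Lg i))].
move=> i phi tphi.
pose psi := phi \o dilate t^-1.
have tV0 : 0 < t^-1 by rewrite invr_gt0.
have tpsi : test_function Om psi.
  by rewrite -(preimage_dilate_Omega tV0); exact: test_function_dilate.
have phiE : phi = psi \o dilate t by apply/funext => x; rewrite /psi/= dilateK.
have [Lpsi Ldpsi] := test_function_L2 tpsi.
pose F y := Complex (dil_factor t i) 0 * (u y * cpartial i psi y).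
pose G y := Complex (dil_factor t i) 0 * (g i y * psi y).
have -> : (fun x => (u \o dilate t) x * cpartial i phi x) = (fun x => F (dilate t x)).
  by apply/funext => x /=; rewrite phiE (cpartial_dilate t0 i x tpsi) mulrCA.
have -> : (fun x => dilate_grad g i x * phi x) = (fun x => G (dilate t x)).
  by apply/funext => x /=; rewrite /G phiE /dilate_grad/= mulrA.
have mOm := @measurable_Omega R.
rewrite (cintegral_dilate (F:=F)); last first.
  by apply/cmeasurable_scale/cmeasurable_mul; exact: L2_cmeasurable.
rewrite (cintegral_dilate (F:=G)); last first.
  by apply/cmeasurable_scale/cmeasurable_mul; exact: L2_cmeasurable.
by rewrite !cintegral_scale// ibp// !mulrN.
Qed.

(** If v approximates u, then v o S_t approximates u o S_t: the change of variables
    multiplies all the squared norms by at most t^-1 (1 + t^2). *)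
Lemma zero_trace_dilate u g : L2 Om u -> (forall i, L2 Om (g i)) ->
  zero_trace k0 u g -> zero_trace k0 (u \o dilate t) (dilate_grad g).
Proof.
move=> Lu Lg tr eps eps0.
have t2 : 0 < 1 + t ^+ 2 by rewrite ltr_pwDl// sqr_ge0.
pose c := t^-1 * (1 + t ^+ 2).
have c0 : 0 < c by rewrite mulr_gt0 ?invr_gt0.
have [v [tv lev levS]] := tr (eps / c) (divr_gt0 eps0 c0).
have mOm := @measurable_Omega R.
have [Lv Ldv] := test_function_L2 tv.
have cmB (a b : pt3 R -> C) : L2 Om a -> L2 Om b -> cmeasurable Om (fun x => a x - b x).
  by move=> La Lb; apply: cmeasurable_sub; exact: L2_cmeasurable.
have scaled : (c%:E * (eps / c)%:E = eps%:E)%E by rewrite -EFinM mulrC divfK// gt_eqF.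
exists (v \o dilate t); split.
- exact: (test_function_dilate t0 tv).
- set S := (X in (X < _)%E) in lev.
  rewrite -scaled; apply: (@le_lt_trans _ _ (c%:E * S)%E); last first.
    by rewrite lte_pmul2l ?lte_fin.
  have sq0 (w : pt3 R -> C) : (0 <= sqnorm Om w)%E.
    by apply: integral_ge0 => x _; rewrite lee_fin sqr_ge0.
  have le_sq (b : R) (w : pt3 R -> C) : 0 <= b <= c -> (b%:E * sqnorm Om w <= c%:E * sqnorm Om w)%E.
    by move=> /andP[b0 bc]; rewrite lee_wpmul2r// lee_fin.
  rewrite /S ge0_muleDr//; last by apply: sume_ge0.
  apply: leeD.
    rewrite (sqnorm_dilate t0 (cmB _ _ Lu Lv)) le_sq// invr_ge0 ltW//=.
    by rewrite ler_peMr ?invr_ge0 ?ltW// ltrDl exprn_gt0.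
  rewrite ge0_sume_distrr//; apply: lee_sum => i _.
  pose w y := g i y - cpartial i v y.
  have mw : cmeasurable Om w := cmB _ _ (Lg i) (Ldv i).
  have mwt : cmeasurable Om (w \o dilate t).
    case: mw => mR mI; split; first exact: (measurable_comp_dilate t0 mR).
    exact: (measurable_comp_dilate t0 mI).
  rewrite (_ : (fun x => _) = (fun x => Complex (dil_factor t i) 0 * (w \o dilate t) x)); last first.
    by apply/funext => x; rewrite /dilate_grad (cpartial_dilate t0 i x tv) /= mulrBr.
  rewrite (sqnorm_scale _ mOm mwt) (sqnorm_dilate t0 mw) muleA -EFinM le_sq//.
  rewrite mulr_ge0 ?sqr_ge0 ?invr_ge0 ?(ltW t0)//= /c [_ ^+ 2 * _]mulrC ler_pM2l ?invr_gt0//.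
  by rewrite /dil_factor; case: ifP => _; rewrite ?expr1n ?lerDr ?lerDl ?sqr_ge0.
- have [cR cI _ _] := test_function_continuous tv.
  rewrite (sqnorm_Sigma_dilate t0 cR cI) -scaled.
  apply: (@le_lt_trans _ _ (c%:E * sqnorm_Sigma k0 v)%E); last first.
    by rewrite lte_pmul2l ?lte_fin.
  rewrite lee_wpmul2r//.
    by rewrite adde_ge0//; apply: integral_ge0 => x _; rewrite lee_fin sqr_ge0.
  by rewrite lee_fin ler_peMr ?invr_ge0 ?(ltW t0)// lerDl sqr_ge0.
Qed.

Lemma H10_grad_dilate u g : H10_grad k0 u g -> H10_grad k0 (u \o dilate t) (dilate_grad g).
Proof.
move=> [H1 tr]; split; first exact: H1_grad_dilate.
by case: H1 => Lu Lg _; exact: zero_trace_dilate.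
Qed.

End DilatedH10.

(** * The real inner product on L^2 *)

Section RealInnerProduct.
Variable R : realType.
Local Notation C := R[i].
Local Notation leb3 := (@leb3 R).
Local Notation k0 := ((0 : R)%R, (0 : R)%R).
Local Notation Om := (Omega k0).
Implicit Types (u v w : pt3 R -> C).

(** The inner product of R^2 = C; its integral [ip] is the real part of the inner
    product of L^2.  Once the eigenvalue is known to be real, the real part of the
    weak equation carries all the information needed, and [ip] is symmetric. *)
Definition redot (z w : C) : R :=
  complex.Re z * complex.Re w + complex.Im z * complex.Im w.

Definition ip u v : R := (\int[leb3]_(x in Om) redot (u x) (v x))%R.

Definition nrm2 u : R := (\int[leb3]_(x in Om) sqmod (u x))%R.

Let mOm : measurable Om := @measurable_Omega R.

Lemma redot_conj (z w : C) : redot z w = complex.Re (z * w^*%C).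
Proof. by case: z w => [a b] [c d]; rewrite /redot /= mulrN opprK. Qed.

Lemma redotC (z w : C) : redot z w = redot w z.
Proof. by rewrite /redot mulrC [X in _ + X]mulrC. Qed.

Lemma redot_scale (c : R) (z w : C) : redot z (Complex c 0 * w) = c * redot z w.
Proof. by rewrite /redot Re_scale Im_scale; ring. Qed.

Lemma normr_redot_le (z w : C) : `|redot z w| <= sqmod z + sqmod w.
Proof.
rewrite /redot /sqmod; case: z w => [a b] [c d] /=.
have := sqr_ge0 (a + c); have := sqr_ge0 (a - c).
have := sqr_ge0 (b + d); have := sqr_ge0 (b - d).
by rewrite ler_norml => ? ? ? ?; apply/andP; split; nra.
Qed.

Lemma measurable_redot u v : cmeasurable Om u -> cmeasurable Om v ->
  measurable_fun Om (fun x => redot (u x) (v x)).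
Proof. by move=> [uR uI] [vR vI]; apply: measurable_funD; exact: measurable_funM. Qed.

Lemma integrable_redot u v : L2 Om u -> L2 Om v ->
  leb3.-integrable Om (fun x => (redot (u x) (v x))%:E).
Proof.
move=> Lu Lv; apply: (integrable_pairing mOm Lu Lv) => [|x _]; last exact: normr_redot_le.
by apply: measurable_redot; exact: L2_cmeasurable.
Qed.

Lemma ipC u v : ip u v = ip v u.
Proof. by apply: eq_Rintegral => x _; rewrite redotC. Qed.

Lemma ip_scale (c : R) u v : L2 Om u -> L2 Om v ->
  ip u (fun x => Complex c 0 * v x) = c * ip u v.
Proof.
move=> Lu Lv; rewrite /ip; under eq_Rintegral do rewrite redot_scale.
by rewrite RintegralZl//; exact: integrable_redot.
Qed.

Lemma ip_dilate (t : R) u v : 0 < t -> L2 Om u -> L2 Om v ->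
  ip (u \o dilate t) (v \o dilate t) = t^-1 * ip u v.
Proof.
move=> t0 Lu Lv; rewrite /ip -(Rintegral_dilate t0 (f := fun x => redot (u x) (v x)))//.
by apply: measurable_redot; exact: L2_cmeasurable.
Qed.

(** Dilating both arguments by t^-1 turns the pairing with the inverse dilate into
    the pairing with the dilate.  This is what relates the two test functions of
    the virial argument. *)
Lemma ip_dilateV (t : R) u : 0 < t -> L2 Om u ->
  ip u (u \o dilate t^-1) = t * ip u (u \o dilate t).
Proof.
move=> t0 Lu; have tV0 : 0 < t^-1 by rewrite invr_gt0.
have := ip_dilate tV0 (L2_dilate t0 Lu) Lu; rewrite invrK [in RHS]ipC => <-.
by congr (ip _ _); apply/funext => x /=; rewrite dilateVK.
Qed.

Lemma sqnorm_nrm2 u : L2 Om u -> sqnorm Om u = (nrm2 u)%:E.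
Proof.
move=> Lu; rewrite sqnormE /nrm2 /Rintegral fineK//.
exact: integrable_fin_num (integrable_sqmod mOm Lu).
Qed.

Lemma nrm2_ge0 u : 0 <= nrm2 u.
Proof. by apply: fine_ge0; apply: integral_ge0 => x _; rewrite lee_fin sqmod_ge0. Qed.

Lemma L2_sub u v : L2 Om u -> L2 Om v -> L2 Om (fun x => u x - v x).
Proof.
move=> Lu Lv; have mB := cmeasurable_sub (L2_cmeasurable Lu) (L2_cmeasurable Lv).
case: (mB) => mR mI; split => //; rewrite sqnormE.
have int2 : leb3.-integrable Om (fun x => (2%:E * (sqmod (u x))%:E + 2%:E * (sqmod (v x))%:E)%E).
  by apply: integrableD => //; apply: integrableZl => //; exact: integrable_sqmod.
have int2y : (\int[leb3]_(x in Om) (2%:E * (sqmod (u x))%:E + 2%:E * (sqmod (v x))%:E) < +oo)%E.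
  exact: integrable_lty.
apply: (le_lt_trans _ int2y).
apply: ge0_le_integral => //.
- by move=> x _; rewrite lee_fin sqmod_ge0.
- exact: measurable_sqmod.
- exact: measurable_int int2.
- move=> x _; rewrite lee_fin /sqmod Re_sub Im_sub.
  have := sqr_ge0 (complex.Re (u x) + complex.Re (v x)).
  have := sqr_ge0 (complex.Im (u x) + complex.Im (v x)).
  nra.
Qed.

Lemma integrable_lincomb (a b : R) (f g : pt3 R -> R) :
  leb3.-integrable Om (EFin \o f) -> leb3.-integrable Om (EFin \o g) ->
  leb3.-integrable Om (EFin \o (fun x => a * f x + b * g x)).
Proof.
move=> intf intg.
suff : leb3.-integrable Om (fun x => a%:E * (f x)%:E + b%:E * (g x)%:E)%E by [].
by apply: integrableD => //; exact: integrableZl.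
Qed.

Lemma Rintegral_lincomb (a b : R) (f g : pt3 R -> R) :
  leb3.-integrable Om (EFin \o f) -> leb3.-integrable Om (EFin \o g) ->
  (\int[leb3]_(x in Om) (a * f x + b * g x) =
   a * \int[leb3]_(x in Om) f x + b * \int[leb3]_(x in Om) g x)%R.
Proof.
move=> intf intg.
have scaled c (k : pt3 R -> R) : leb3.-integrable Om (EFin \o k) ->
    leb3.-integrable Om (EFin \o (fun x => c * k x)).
  move=> intk; suff : leb3.-integrable Om (fun x => c%:E * (k x)%:E)%E by [].
  exact: integrableZl.
rewrite RintegralD; [|exact: mOm|exact: scaled|exact: scaled].
by rewrite RintegralZl// RintegralZl.
Qed.

Lemma nrm2_sub u v : L2 Om u -> L2 Om v ->
  nrm2 (fun x => u x - v x) = nrm2 u + nrm2 v - 2 * ip u v.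
Proof.
move=> Lu Lv.
have iu := integrable_sqmod mOm Lu; have iv := integrable_sqmod mOm Lv.
have iuv := integrable_redot Lu Lv.
transitivity (1 * (\int[leb3]_(x in Om) (1 * sqmod (u x) + 1 * sqmod (v x)))%R + - 2 * ip u v).
  rewrite -Rintegral_lincomb//; last exact: integrable_lincomb.
  by apply: eq_Rintegral => x _; rewrite /sqmod /redot Re_sub Im_sub; ring.
by rewrite Rintegral_lincomb// !mul1r mulNr.
Qed.

Lemma nrm2_triangle u v w : L2 Om u -> L2 Om v -> L2 Om w ->
  nrm2 (fun x => u x - w x) <= 2 * nrm2 (fun x => u x - v x) + 2 * nrm2 (fun x => v x - w x).
Proof.
move=> Lu Lv Lw.
have iuv := integrable_sqmod mOm (L2_sub Lu Lv).
have ivw := integrable_sqmod mOm (L2_sub Lv Lw).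
rewrite -Rintegral_lincomb//; apply: le_Rintegral => //.
- by apply: integrable_sqmod => //; exact: L2_sub.
- exact: integrable_lincomb.
- move=> x _; rewrite /sqmod !Re_sub !Im_sub.
  set a := complex.Re (u x); set b := complex.Re (w x); set c := complex.Re (v x).
  set a' := complex.Im (u x); set b' := complex.Im (w x); set c' := complex.Im (v x).
  have := sqr_ge0 (a - 2 * c + b); have := sqr_ge0 (a' - 2 * c' + b'); nra.
Qed.
End RealInnerProduct.

(** * Strong continuity of dilations in L^2 *)

Section DilationContinuity.
Variable R : realType.
Local Notation C := R[i].
Local Notation leb3 := (@leb3 R).
Local Notation k0 := ((0 : R)%R, (0 : R)%R).
Local Notation Om := (Omega k0).
Implicit Types (u v w : pt3 R -> C).

Let mOm : measurable Om := @measurable_Omega R.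

Lemma nrm2_dilate (t : R) u : 0 < t -> L2 Om u -> nrm2 (u \o dilate t) = t^-1 * nrm2 u.
Proof.
move=> t0 Lu; rewrite /nrm2 -(Rintegral_dilate t0 (f := fun x => sqmod (u x)))//.
by apply/measurable_EFinP; apply: measurable_sqmod mOm (L2_cmeasurable Lu).
Qed.

Lemma continuous_sqmod v : continuous (fun x => complex.Re (v x)) ->
  continuous (fun x => complex.Im (v x)) -> continuous (fun x => sqmod (v x)).
Proof.
by move=> cR cI x; apply: cvgD; exact: continuous_sqr.
Qed.

(** Dominated convergence along t = 1 + 1 / (n + 1).  For t > 1 the support of the
    dilate stays in any centred box that contains the original support, so a
    multiple of the indicator of the box dominates. *)
Lemma nrm2_dilate_sub_small K v (eps : R) : compact K ->
  continuous (fun x => complex.Re (v x)) -> continuous (fun x => complex.Im (v x)) ->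
  vanishes_off K (fun x => complex.Re (v x)) -> vanishes_off K (fun x => complex.Im (v x)) ->
  0 < eps -> exists2 t, 1 < t & nrm2 (fun x => v (dilate t x) - v x) < eps.
Proof.
move=> cK cR cI vR vI eps0.
have Lv : L2 Om v by exact: (L2_compactly_supported mOm cK).
have [M [L [M0 L0 vM]]] : exists M L, [/\ 0 <= M, 0 <= L &
    forall x, sqmod (v x) <= M * \1_(box L) x].
  have [||M [L [M0 L0 vM]]] := @compactly_supported_bound R K (fun x => sqmod (v x)) cK.
  - exact: continuous_sqmod.
  - by move=> x nKx; rewrite /sqmod vR// vI// expr0n addr0.
  by exists M, L; split => // x; apply: le_trans (vM x); exact: ler_norm.
pose t n : R := 1 + n.+1%:R^-1.
have t1 n : 1 < t n by rewrite ltrDl invr_gt0.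
have t0 n : 0 < t n by exact: lt_trans (t1 n).
have cvgt : t n @[n --> \oo] --> (1 : R).
  rewrite -[X in _ --> X]addr0; apply: cvgD; first exact: cvg_cst.
  exact: cvg_harmonic.
pose f n x := (sqmod (v (dilate (t n) x) - v x))%:E.
have Ld n : L2 Om (fun x => v (dilate (t n) x) - v x).
  by apply: L2_sub => //; exact: (L2_dilate (t0 n) Lv).
have mf n : measurable_fun Om (f n) by apply: measurable_sqmod mOm (L2_cmeasurable (Ld n)).
have cvgf x : Om x -> f n x @[n --> \oo] --> (cst 0%E : pt3 R -> \bar R) x.
  move=> _; apply: cvg_EFin; first by near=> n.
  have cpath (h : pt3 R -> R) : continuous h -> h (dilate (t n) x) - h x @[n --> \oo] --> (0 : R).
    move=> ch; rewrite -(subrr (h x)); apply: cvgB; last exact: cvg_cst.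
    have cp : continuous (fun s : R => h (s * x.1.1, x.1.2, x.2)).
      apply: (@continuous_comp_all _ _ _ (fun s : R => (s * x.1.1, x.1.2, x.2)) h) => //.
      apply: (@continuous_comp_all _ _ _ (fun s : R => s * x.1.1) (fun r => (r, x.1.2, x.2))).
        exact: mulrr_continuous.
      exact: continuous_slice1.
    have -> : h x = h (1 * x.1.1, x.1.2, x.2) by rewrite mul1r; case: (x) => -[].
    apply: (@cvg_comp _ _ _ t (fun s : R => h (s * x.1.1, x.1.2, x.2)) _ (nbhs (1 : R))) => //.
    exact: cp.
  have aR := cpath _ cR; have aI := cpath _ cI.
  pose reB n := complex.Re (v (dilate (t n) x)) - complex.Re (v x).
  pose imB n := complex.Im (v (dilate (t n) x)) - complex.Im (v x).
  have -> : (fine \o f^~ x) = (fun n => reB n * reB n + imB n * imB n).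
    by apply/funext => n; rewrite /= /sqmod Re_sub Im_sub !expr2.
  have -> : 0 = 0 * 0 + 0 * 0 :> R by rewrite mulr0 addr0.
  by apply: cvgD; apply: cvgM.
pose g x := (4 * M * \1_(box L) x)%:E.
have ig : leb3.-integrable Om g by exact: integrable_box.
have fg n x : Om x -> (`|f n x| <= g x)%E.
  move=> _; rewrite /f /g gee0_abs ?lee_fin ?sqmod_ge0//.
  have box_dil : \1_(box L) (dilate (t n) x) <= \1_(box L) x :> R.
    rewrite !indicE ler_nat; case: (boolP (_ \in _)) => //; rewrite inE => -[[/= bx by_] bz].
    rewrite mem_set//; split => //; split => //=.
    move: bx; rewrite /= !in_itv/= -!ler_norml normrM => bx.
    by apply: le_trans bx; rewrite ler_peMl// ger0_norm ltW.
  have s2 (z w : C) : sqmod (z - w) <= 2 * sqmod z + 2 * sqmod w.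
    rewrite /sqmod Re_sub Im_sub.
    have := sqr_ge0 (complex.Re z + complex.Re w).
    have := sqr_ge0 (complex.Im z + complex.Im w); nra.
  apply: le_trans (s2 _ _) _.
  have := vM x; have := vM (dilate (t n) x).
  have := ler_wpM2l M0 box_dil; lra.
have := @dominated_cvg _ _ _ leb3 Om mOm f (cst 0%E) g mf cvgf _ ig fg.
rewrite integral_cst// mul0e => /(_ (fun _ _ => isT)) cvI.
have : \forall n \near \oo, (\int[leb3]_(x in Om) f n x < eps%:E)%E.
  apply: (cvI (fun y => (y < eps%:E)%E)).
  apply: open_nbhs_nbhs; split; last by rewrite /= lte_fin.
  exact: open_ereal_lt_ereal.
move=> [N _ /(_ N (leqnn N)) NI].
exists (t N) => //.
by rewrite -lte_fin -sqnorm_nrm2// sqnormE.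
Unshelve. all: by end_near. Qed.

(** By orthogonality, the squared distance from w to w o S_t is at least the squared
    norm of w; by strong continuity, tested on an approximation of w with compact
    support, that distance is arbitrarily small for t close to 1. *)
Lemma dilation_orthogonal_eq0 w : L2 Om w ->
  (forall t : R, 1 < t -> ip w (w \o dilate t) = 0) ->
  (forall eps : R, 0 < eps -> exists v K, [/\ compact K,
     continuous (fun x => complex.Re (v x)) /\ continuous (fun x => complex.Im (v x)),
     vanishes_off K (fun x => complex.Re (v x)), vanishes_off K (fun x => complex.Im (v x)) &
     nrm2 (fun x => w x - v x) < eps]) ->
  nrm2 w = 0.
Proof.
move=> Lw orth dense; apply/eqP; rewrite eq_le nrm2_ge0 andbT.
apply/ler_addgt0Pl => e e0; rewrite addr0.
(* Ten errors are added up: 2 * 1 for w - v dilated, then 2 * (2 * 1 + 2 * 1) for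
   the dilate of v minus v and for v - w. *)
have e10 : 0 < e / 10 by rewrite divr_gt0.
have [v [K [cK [cR cI] vR vI wv]]] := dense _ e10.
have [t t1 vtv] := nrm2_dilate_sub_small cK cR cI vR vI e10.
have t0 : 0 < t by exact: lt_trans t1.
have Lv : L2 Om v by exact: (L2_compactly_supported mOm cK).
have Lwt := L2_dilate t0 Lw; have Lvt := L2_dilate t0 Lv.
have h1 : nrm2 w <= nrm2 (fun x => (w \o dilate t) x - w x).
  by rewrite nrm2_sub// ipC orth// mulr0 subr0 lerDr nrm2_ge0.
have h2 := nrm2_triangle Lwt Lvt Lw.
have h3 := nrm2_triangle Lvt Lv Lw.
have h4 : nrm2 (fun x => (w \o dilate t) x - (v \o dilate t) x) <= nrm2 (fun x => w x - v x).
  rewrite (nrm2_dilate t0 (L2_sub Lw Lv)) ler_piMl ?nrm2_ge0// invf_le1// ltW//.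
have h5 : nrm2 (fun x => v x - w x) = nrm2 (fun x => w x - v x).
  by apply: eq_Rintegral => x _; rewrite /sqmod !Re_sub !Im_sub; ring.
move: h1 h2 h3 h4 h5 wv vtv; rewrite /comp /=; lra.
Qed.
End DilationContinuity.

(** * A weighted inequality on the half-line *)

Section WeightedInequality1.
Variable R : realType.
Local Notation mu := (@lebesgue_measure R).
Variables (a b : R -> R) (L delta : R).
Hypotheses (L0 : 0 < L) (delta0 : 0 < delta).
Hypothesis da : forall x : R, is_derive x 1 a (b x).
Hypothesis cb : continuous b.
Hypothesis aL : forall x, L <= x -> a x = 0.

Let ca : continuous a.
Proof.
move=> x; apply: differentiable_continuous; apply/derivable1_diffP; exact: ex_derive.
Qed.

Let F (x : R) := (1 - expR (- x)) * (a x * a x).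
Let f (x : R) := expR (- x) * (a x * a x) + (1 - expR (- x)) * (2 * (a x * b x)).

Let dF (x : R) : is_derive x 1 F (f x).
Proof.
have da' := da x.
have de : is_derive x 1 (fun y : R => expR (- y)) (- expR (- x)).
  have := @is_derive1_comp R expR -%R x (expR (- x)) (-1) _ _.
  rewrite mulrN1; apply.
have := @is_deriveM _ _ _ _ x 1 _ _
  (is_deriveB (is_derive_cst (1 : R) x 1) de) (is_deriveM da' da').
move=> /is_derive_eq; apply.
rewrite /f /GRing.scale /= -[(cst 1 - _) x]/(1 - expR (- x)) -[(a * a) x]/(a x * a x); ring.
Qed.

Let cE : continuous (fun x : R => expR (- x)).
Proof.
apply: (@continuous_comp_all _ _ _ -%R expR); first exact: opp_continuous.
exact: continuous_expR.
Qed.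

Let cf : continuous f.
Proof.
move=> x; apply: cvgD; apply: cvgM.
- exact: cE.
- by apply: cvgM; exact: ca.
- by apply: cvgB; [exact: cvg_cst|exact: cE].
- by apply: cvgMr; apply: cvgM; [exact: ca|exact: cb].
Qed.

Let integral_f : (\int[mu]_(x in `[0%R, L]) (f x)%:E = 0)%E.
Proof.
have cF x : F y @[y --> x] --> F x.
  by apply: differentiable_continuous; apply/derivable1_diffP; exact: ex_derive.
rewrite (@continuous_FTC2 R f F 0 L)//.
- by rewrite /F aL// oppr0 expR0 subrr !mul0r mulr0 subee.
- exact: continuous_subspaceT.
- split.
  + by move=> x _; exact: ex_derive.
  + by apply: cvg_at_right_filter; exact: cF.
  + by apply: cvg_at_left_filter; exact: cF.
- by move=> x _; rewrite derive1E; apply: derive_val.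
Qed.

(** On the half-line, 0 is the integral of the derivative of (1 - exp (- x)) a^2, where
    a vanishes for large x.  Hence the integral of exp (- x) a^2 is that of
    - 2 (1 - exp (- x)) a a', and the weight 1 - exp (- x), bounded by 1, allows
    for the inequality of arithmetic and geometric means. *)
Lemma weighted_inequality1 :
  (\int[mu]_(x in `]0%R, +oo[) (expR (- x) * a x ^+ 2)%:E <=
   \int[mu]_(x in `]0%R, +oo[) (delta * a x ^+ 2 + delta^-1 * b x ^+ 2)%:E)%E.
Proof.
pose k x := delta * a x ^+ 2 + delta^-1 * b x ^+ 2.
have k0 x : 0 <= k x by rewrite addr_ge0// mulr_ge0 ?sqr_ge0 ?invr_ge0 ?ltW.
have ck : continuous k.
  have -> : k = (fun x => delta * (a x * a x) + delta^-1 * (b x * b x)).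
    by apply/funext => x; rewrite /k !expr2.
  move=> x; apply: cvgD; apply: cvgMr; apply: cvgM; try exact: ca; exact: cb.
pose w x := expR (- x) * a x ^+ 2.
have w0 x : 0 <= w x by rewrite mulr_ge0 ?sqr_ge0 ?expR_ge0.
have cw : continuous w.
  have -> : w = (fun x => expR (- x) * (a x * a x)).
    by apply/funext => x; rewrite /w !expr2.
  move=> x; apply: cvgM; first exact: cE.
  by apply: cvgM; exact: ca.
have icont (h : R -> R) : continuous h -> mu.-integrable `[0%R, L] (EFin \o h).
  move=> ch; apply: continuous_compact_integrable; first exact: segment_compact.
  exact: continuous_subspaceT.
apply: (@le_trans _ _ (\int[mu]_(x in `[0%R, L]) (k x)%:E)%E); last first.
  rewrite integral_itv_obnd_cbnd; last first.
    by apply: measurable_funTS; apply/measurable_EFinP; exact: continuous_measurable_fun.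
  apply: ge0_subset_integral => //.
  - by apply: measurable_funTS; apply/measurable_EFinP; exact: continuous_measurable_fun.
  - by move=> x _; rewrite lee_fin.
  - by move=> x /=; rewrite !in_itv/= andbT => /andP[].
apply: (@le_trans _ _ (\int[mu]_(x in `[0%R, L]) (w x)%:E)%E).
  rewrite integral_itv_obnd_cbnd; last first.
    by apply: measurable_funTS; apply/measurable_EFinP; exact: continuous_measurable_fun.
  rewrite integral_mkcond [leRHS]integral_mkcond le_eqVlt; apply/orP; left; apply/eqP.
  apply: eq_integral => x _; rewrite !patchE !mem_setE !in_itv/= andbT.
  case: (leP 0 x) => //= x0; case: (leP x L) => // /ltW Lx.
  by rewrite aL// expr0n mulr0.
apply: (@le_trans _ _ (\int[mu]_(x in `[0%R, L]) ((f x)%:E + (k x)%:E))%E); last first.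
  by rewrite integralD//; [rewrite integral_f add0e|exact: icont|exact: icont].
apply: le_integral => //.
- exact: icont.
- by apply: integrableD => //; exact: icont.
move=> x; rewrite inE/= in_itv/= => /andP[x0 _]; rewrite lee_fin /w /f /k.
have e0 := expR_ge0 (- x).
have e1 : expR (- x) <= 1 by rewrite expR_le1 oppr_le0.
set s := expR (- x) in e0 e1 *; set c := 1 - s.
(* The right-hand side is a square in a x plus a nonnegative multiple of
   (b x)^2, as |c| <= 1. *)
have sq1 : 0 <= delta * (a x + c * delta^-1 * b x) ^+ 2.
  by rewrite mulr_ge0 ?sqr_ge0// ltW.
have sq2 : 0 <= delta^-1 * ((1 - c ^+ 2) * b x ^+ 2).
  rewrite mulr_ge0 ?invr_ge0 ?(ltW delta0)// mulr_ge0 ?sqr_ge0// /c; nra.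
have dd : delta * delta^-1 = 1 by rewrite divff// gt_eqF.
have sq12 : delta * (a x + c * delta^-1 * b x) ^+ 2 + delta^-1 * ((1 - c ^+ 2) * b x ^+ 2) =
    delta * a x ^+ 2 + delta^-1 * b x ^+ 2 + c * (2 * (a x * b x)) by field; rewrite gt_eqF.
rewrite !expr2 in sq1 sq2 sq12 *; lra.
Qed.
End WeightedInequality1.

(** * The weighted inequality on the domain *)

Section SigmaFinite.
Variable R : realType.
Local Notation mu := (@lebesgue_measure R).

(** Squares over a countable cover of the line by sets of finite measure cover
    the plane.  The structure built from this lemma lets Tonelli's theorem apply to
    the plane as the first factor of the space. *)
Lemma leb2_sigma_finite : sigma_finite [set: R * R] (@leb2 R).
Proof.
have /sigma_finiteP[F [TF ndF Foo]] := sigma_finiteT mu.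
exists (fun n => F n `*` F n).
  rewrite -setXTT TF predeqE => -[x y]; split.
    move=> [/= [n _ Fnx] [k _ Gky]]; exists (maxn n k) => //; split.
    - by move: x Fnx; exact/subsetPset/ndF/leq_maxl.
    - by move: y Gky; exact/subsetPset/ndF/leq_maxr.
  by move=> [n _ []/= ? ?]; split; exists n.
move=> k; have [mF Fk] := Foo k.
split; first exact: measurableX.
rewrite /leb2 product_measure1E// lte_mul_pinfty// ge0_fin_numE//.
Qed.
HB.instance Definition _ := Measure.on (@leb2 R).
HB.instance Definition _ := Measure_isSigmaFinite.Build _ _ _ (@leb2 R) leb2_sigma_finite.

End SigmaFinite.

Section Slices.
Variable R : realType.
Local Notation mu := (@lebesgue_measure R).
Local Notation leb2 := (@leb2 R).
Local Notation leb3 := (@leb3 R).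
Local Notation k0 := ((0 : R)%R, (0 : R)%R).
Local Notation Om := (Omega k0).

(** Tonelli's theorem, applied twice: to the plane times the vertical line, then to
    the two factors of the plane. *)
Lemma le_integral_slices (G H : pt3 R -> \bar R) :
  measurable_fun [set: pt3 R] G -> measurable_fun [set: pt3 R] H ->
  (forall x, 0 <= G x)%E -> (forall x, 0 <= H x)%E ->
  (forall y z, \int[mu]_x G (x, y, z) <= \int[mu]_x H (x, y, z))%E ->
  (\int[leb3]_x G x <= \int[leb3]_x H x)%E.
Proof.
move=> mG mH G0 H0 GH.
have slice2 (F : pt3 R -> \bar R) z : measurable_fun [set: pt3 R] F -> (forall x, 0 <= F x)%E ->
    fubini_G leb2 F z = (\int[mu]_y fubini_G mu (fun p => F (p, z)) y)%E.
  move=> mF F0; rewrite /fubini_G.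
  rewrite (@fubini_tonelli2 _ _ _ _ R mu mu (fun p => F (p, z)))//.
  exact: (measurable_fun_pair1 z mF).
have slice3 (F : pt3 R -> \bar R) : measurable_fun [set: pt3 R] F -> (forall x, 0 <= F x)%E ->
    (\int[leb3]_x F x = \int[mu]_z fubini_G leb2 F z)%E.
  move=> mF F0.
  exact: (@fubini_tonelli2 _ _ _ _ R leb2 mu F mF F0).
rewrite !slice3//.
apply: ge0_le_integral => //.
- by move=> z _; apply: integral_ge0.
- exact: (measurable_fun_fubini_tonelli_G (m1:=leb2) G mG G0).
- exact: (measurable_fun_fubini_tonelli_G (m1:=leb2) H mH H0).
move=> z _; rewrite !slice2//; apply: ge0_le_integral => //.
- by move=> y _; apply: integral_ge0.
- apply: (measurable_fun_fubini_tonelli_G (m1:=mu) (fun p => G (p, z))) => //.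
  exact: (measurable_fun_pair1 z mG).
- apply: (measurable_fun_fubini_tonelli_G (m1:=mu) (fun p => H (p, z))) => //.
  exact: (measurable_fun_pair1 z mH).
- by move=> y _; exact: GH.
Qed.

Lemma le_integral_Omega_slices (G H : pt3 R -> R) : continuous G -> continuous H ->
  (forall x, 0 <= G x) -> (forall x, 0 <= H x) ->
  (forall y z, \int[mu]_(x in `]0%R, +oo[) (G (x, y, z))%:E <=
               \int[mu]_(x in `]0%R, +oo[) (H (x, y, z))%:E)%E ->
  (\int[leb3]_(x in Om) (G x)%:E <= \int[leb3]_(x in Om) (H x)%:E)%E.
Proof.
move=> cG cH G0 H0 GH; rewrite integral_mkcond [leRHS]integral_mkcond.
have mr (F : pt3 R -> R) : continuous F ->
    measurable_fun [set: pt3 R] ((fun x => (F x)%:E) \_ Om).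
  move=> cF; apply/(measurable_restrictT _ (@measurable_Omega R)).
  by apply: measurable_funTS; apply/measurable_EFinP; exact: continuous_measurable3.
have r0 (F : pt3 R -> R) : (forall x, 0 <= F x) -> forall x, (0 <= ((fun x => (F x)%:E) \_ Om) x)%E.
  by move=> F0 x; apply: erestrict_ge0 => y _; rewrite lee_fin.
apply: le_integral_slices; [exact: mr|exact: mr|exact: r0|exact: r0|].
move=> y z; have [yz|yz] := pselect (0 < y /\ 0 < z < 1).
  have sl (F : pt3 R -> R) : (\int[mu]_x ((fun x => (F x)%:E) \_ Om) (x, y, z) =
      \int[mu]_(x in `]0%R, +oo[) (F (x, y, z))%:E)%E.
    rewrite [RHS]integral_mkcond; apply: eq_integral => x _; rewrite !patchE.
    rewrite mem_setE in_itv/= andbT; congr (if _ then _ else _).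
    case: yz => y0 z01; apply/idP/idP; rewrite in_setE /Omega/= !mul0r; first by case.
    by move=> x0; split.
  by rewrite !sl.
have sl (F : pt3 R -> R) : (\int[mu]_x ((fun x => (F x)%:E) \_ Om) (x, y, z) = 0)%E.
  rewrite integral0_eq// => x _; rewrite patchE; case: ifP => //.
  by rewrite in_setE /Omega/= !mul0r => -[_ y0 z01]; exfalso; exact: yz.
by rewrite !sl.
Qed.

Lemma is_derive_slice1 (h : pt3 R -> R) (x y z : R) :
  derivable h (x, y, z) (basis3 R 0) ->
  is_derive x 1 (fun s : R => h (s, y, z)) (partial 0 h (x, y, z)).
Proof.
have quot : (fun k : R => k^-1 *: ((h \o shift (x, y, z)) (k *: basis3 R 0) - h (x, y, z))) =
    (fun k : R => k^-1 *: (((fun s : R => h (s, y, z)) \o shift x) (k *: 1) - h (x, y, z))).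
  apply/funext => k /=; congr (_ *: (h _ - _)).
  by rewrite /basis3/=; congr (_, _, _); rewrite /= scaler0 add0r.
by rewrite /derivable /partial /derive quot => dh; exact: (DeriveDef dh erefl).
Qed.

(** The one-dimensional inequality holds on each horizontal half-line parallel to the
    x1-axis, and both sides are integrals of nonnegative functions. *)
Lemma weighted_inequality3 (h : pt3 R -> R) K (delta : R) : 0 < delta -> smooth h ->
  compact K -> vanishes_off K h ->
  (\int[leb3]_(x in Om) (expR (- x.1.1) * h x ^+ 2)%:E <=
   \int[leb3]_(x in Om) (delta * h x ^+ 2 + delta^-1 * partial 0 h x ^+ 2)%:E)%E.
Proof.
move=> delta0 sh cK hK.
have ch : continuous h by exact: (sh [::]).1.
have cdh : continuous (partial 0 h) by exact: (sh [:: 0]).1.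
have [L L0 KL] := compact_sub_box cK.
apply: le_integral_Omega_slices.
- move=> x; apply: cvgM; last exact: continuous_sqr.
  apply: (@continuous_comp_all _ _ _ (fun x : pt3 R => - x.1.1) expR); last exact: continuous_expR.
  by move=> {}x; apply: cvgN; exact: continuous_coord1.
- by move=> x; apply: cvgD; apply: cvgMr; exact: continuous_sqr.
- by move=> x; rewrite mulr_ge0 ?expR_ge0 ?sqr_ge0.
- by move=> x; rewrite addr_ge0// mulr_ge0 ?sqr_ge0 ?invr_ge0 ?(ltW delta0).
move=> y z.
apply: (@weighted_inequality1 R (fun s => h (s, y, z))
  (fun s => partial 0 h (s, y, z)) (L + 1)) => //.
- by rewrite ltr_wpDl.
- by move=> x; apply: is_derive_slice1; exact: (sh [::]).2.
- exact: (continuous_comp_all (@continuous_slice1 R y z) cdh).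
- move=> x Lx; apply: hK => /KL[[/= + _] _]; rewrite in_itv/= => /andP[_ xL].
  by have := le_trans Lx xL; rewrite gerDl ler10.
Qed.
End Slices.

(** * A function with vanishing x1-derivative is zero *)

Section Final.
Variable R : realType.
Local Notation C := R[i].
Local Notation leb3 := (@leb3 R).
Local Notation k0 := ((0 : R)%R, (0 : R)%R).
Local Notation Om := (Omega k0).
Implicit Types (u v w : pt3 R -> C).

Let mOm : measurable Om := @measurable_Omega R.

Lemma ae_eq0_of_weighted (om : pt3 R -> R) u : measurable_fun Om om ->
  (forall x, 0 < om x) -> cmeasurable Om u ->
  (\int[leb3]_(x in Om) (om x * sqmod (u x))%:E = 0)%E -> ae_eq_on Om u (fun=> 0).
Proof.
move=> mom om0 mu int0.
have mF : measurable_fun Om (fun x => (om x * sqmod (u x))%:E).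
  apply/measurable_EFinP; apply: measurable_funM => //.
  by apply/measurable_EFinP; exact: measurable_sqmod mOm mu.
have : (\int[leb3]_(x in Om) `|(om x * sqmod (u x))%:E| = 0)%E.
  rewrite -[RHS]int0; apply: eq_integral => x _.
  by rewrite gee0_abs// lee_fin mulr_ge0 ?sqmod_ge0// ltW.
move/(ae_eq_integral_abs leb3 mOm mF).
apply: filterS => x /[apply] /= -[/eqP]; rewrite mulf_eq0 gt_eqF//= => /eqP.
case: (u x) => a b; rewrite /sqmod/= => /eqP.
by rewrite paddr_eq0 ?sqr_ge0// !sqrf_eq0 => /andP[/eqP -> /eqP ->].
Qed.

(** A positive weight that is bounded on the domain and has a bounded antiderivative
    along x1. *)
Definition decay (x : pt3 R) : R := expR (- x.1.1).

Lemma continuous_decay : continuous decay.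
Proof.
apply: (@continuous_comp_all _ _ _ (fun x : pt3 R => - x.1.1) expR); last exact: continuous_expR.
by move=> x; apply: cvgN; exact: continuous_coord1.
Qed.

Lemma decay_Omega x : Om x -> 0 <= decay x <= 1.
Proof.
rewrite /Omega/= mul0r => -[x0 _ _].
by rewrite expR_ge0/= -expR0 ler_expR oppr_le0 ltW.
Qed.

Definition wnrm2 u : R := (\int[leb3]_(x in Om) (decay x * sqmod (u x)))%R.

Lemma integrable_wsqmod u : L2 Om u ->
  leb3.-integrable Om (EFin \o (fun x => decay x * sqmod (u x))).
Proof.
move=> Lu; apply: (integrable_pairing mOm Lu Lu).
  apply: measurable_funM.
    by apply: measurable_funTS; apply: continuous_measurable3; exact: continuous_decay.
  by apply/measurable_EFinP; apply: measurable_sqmod mOm (L2_cmeasurable Lu).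
move=> x /decay_Omega/andP[d0 d1]; have s0 := sqmod_ge0 (u x).
by rewrite ger0_norm ?mulr_ge0//; nra.
Qed.

Lemma wnrm2_test v D (delta : R) : 0 < delta -> test_function D v ->
  wnrm2 v <= delta * nrm2 v + delta^-1 * nrm2 (cpartial 0 v).
Proof.
move=> delta0 tv; have [sR sI _ _] := tv.
have [K [cK _ vR vI _]] := test_function_support tv.
have [Lv Ldv] := test_function_L2 tv.
have iv := integrable_sqmod mOm Lv; have idv := integrable_sqmod mOm (Ldv 0).
have HR := weighted_inequality3 delta0 sR cK vR.
have HI := weighted_inequality3 delta0 sI cK vI.
have [cR cI cPR cPI] := test_function_continuous tv.
have sum_int (f f' : pt3 R -> R) : continuous f -> continuous f' ->
    (forall x, 0 <= f x) -> (forall x, 0 <= f' x) ->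
    (\int[leb3]_(x in Om) (f x)%:E + \int[leb3]_(x in Om) (f' x)%:E =
     \int[leb3]_(x in Om) (f x + f' x)%:E)%E.
  move=> cf cf' f0 f'0; rewrite -ge0_integralD//.
  - by move=> x _; rewrite lee_fin.
  - by apply: measurable_funTS; apply/measurable_EFinP; exact: continuous_measurable3.
  - by move=> x _; rewrite lee_fin.
  - by apply: measurable_funTS; apply/measurable_EFinP; exact: continuous_measurable3.
have wc (f : pt3 R -> R) : continuous f -> continuous (fun x => decay x * f x ^+ 2).
  by move=> cf x; apply: cvgM; [exact: continuous_decay|exact: continuous_sqr].
have lc (f f' : pt3 R -> R) : continuous f -> continuous f' ->
    continuous (fun x => delta * f x ^+ 2 + delta^-1 * f' x ^+ 2).
  by move=> cf cf' x; apply: cvgD; apply: cvgMr; exact: continuous_sqr.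
have w0 (f : pt3 R -> R) x : 0 <= decay x * f x ^+ 2.
  by rewrite mulr_ge0 ?expR_ge0 ?sqr_ge0.
have l0 (f f' : pt3 R -> R) x : 0 <= delta * f x ^+ 2 + delta^-1 * f' x ^+ 2.
  by rewrite addr_ge0// mulr_ge0 ?sqr_ge0 ?invr_ge0 ?(ltW delta0).
have := leeD HR HI.
rewrite (sum_int _ _ (wc _ cR) (wc _ cI) (w0 _) (w0 _)).
rewrite (sum_int _ _ (lc _ _ cR (cPR 0)) (lc _ _ cI (cPI 0)) (l0 _ _) (l0 _ _)).
have -> : (\int[leb3]_(x in Om)
    (decay x * complex.Re (v x) ^+ 2 + decay x * complex.Im (v x) ^+ 2)%:E =
    (wnrm2 v)%:E)%E.
  rewrite /wnrm2 /Rintegral fineK; last exact: integrable_fin_num (integrable_wsqmod Lv).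
  by apply: eq_integral => x _; rewrite -mulrDr.
have il := integrable_lincomb delta delta^-1 iv idv.
rewrite -Rintegral_lincomb//.
rewrite -lee_fin; set I := (\int[leb3]_(x in Om) (delta * _ + _))%R.
have -> : I%:E = (\int[leb3]_(x in Om)
    (delta * sqmod (v x) + delta^-1 * sqmod (cpartial 0 v x))%:E)%E.
  by rewrite /I /Rintegral fineK//; apply: integrable_fin_num => //; exact: il.
congr (_ <= _)%E.
by apply: eq_integral => x _; congr (_%:E); rewrite /sqmod/=; ring.
Qed.

Lemma wnrm2_le u v : L2 Om u -> L2 Om v ->
  wnrm2 u <= 2 * nrm2 (fun x => u x - v x) + 2 * wnrm2 v.
Proof.
move=> Lu Lv.
have iuv := integrable_sqmod mOm (L2_sub Lu Lv).
have iv := integrable_wsqmod Lv.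
rewrite -Rintegral_lincomb//; apply: le_Rintegral => //.
- exact: integrable_wsqmod.
- exact: integrable_lincomb.
move=> x /decay_Omega/andP[d0 d1].
have s2 : sqmod (u x) <= 2 * sqmod (u x - v x) + 2 * sqmod (v x).
  rewrite /sqmod Re_sub Im_sub.
  have := sqr_ge0 (complex.Re (u x) - 2 * complex.Re (v x)).
  have := sqr_ge0 (complex.Im (u x) - 2 * complex.Im (v x)); nra.
have s1 := sqmod_ge0 (u x - v x).
apply: le_trans (ler_wpM2l d0 s2) _; nra.
Qed.

Lemma nrm2_le u v : L2 Om u -> L2 Om v ->
  nrm2 v <= 2 * nrm2 u + 2 * nrm2 (fun x => u x - v x).
Proof.
move=> Lu Lv.
have iuv := integrable_sqmod mOm (L2_sub Lu Lv).
have iu := integrable_sqmod mOm Lu.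
rewrite -Rintegral_lincomb//; apply: le_Rintegral => //.
- exact: integrable_sqmod.
- exact: integrable_lincomb.
move=> x _; rewrite /sqmod Re_sub Im_sub.
have := sqr_ge0 (2 * complex.Re (u x) - complex.Re (v x)).
have := sqr_ge0 (2 * complex.Im (u x) - complex.Im (v x)); nra.
Qed.

(** Take v within delta^2 of u.  Then int exp (- x1) |u|^2 is bounded by delta times
    a constant that depends only on the norm of u. *)
Lemma ae_eq0_of_partial0 u : L2 Om u ->
  (forall eps, 0 < eps -> exists v, [/\ test_function setT v,
     nrm2 (fun x => u x - v x) < eps & nrm2 (cpartial 0 v) < eps]) ->
  ae_eq_on Om u (fun=> 0).
Proof.
move=> Lu dense.
suff w0 : wnrm2 u = 0.
  apply: (@ae_eq0_of_weighted decay u).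
  - by apply: measurable_funTS; apply: continuous_measurable3; exact: continuous_decay.
  - by move=> x; exact: expR_gt0.
  - exact: L2_cmeasurable.
  - rewrite -[LHS]fineK; first by congr (_%:E).
    exact: integrable_fin_num (integrable_wsqmod Lu).
have w_ge0 : 0 <= wnrm2 u.
  apply: fine_ge0; apply: integral_ge0 => x _; rewrite lee_fin.
  by rewrite mulr_ge0 ?sqmod_ge0 ?expR_ge0.
apply/eqP; rewrite eq_le w_ge0 andbT.
apply/ler_addgt0Pl => e e0; rewrite addr0.
have N0 := nrm2_ge0 u.
have c0 : 0 < 10 + 4 * nrm2 u by rewrite ltr_wpDr// mulr_ge0.
(* With N the squared norm of u, the bounds h1 to h7 below add up to
   2 delta^2 + 2 (delta (2 N + 2 delta^2) + delta) <= delta (8 + 4 N). *)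
pose delta := Num.min 1 (e / (10 + 4 * nrm2 u)).
have delta0 : 0 < delta by rewrite lt_min ltr01 divr_gt0.
have delta1 : delta <= 1 by rewrite ge_min lexx.
have deltae : delta * (10 + 4 * nrm2 u) <= e.
  by rewrite -ler_pdivlMr// ge_min lexx orbT.
have d2 : 0 < delta ^+ 2 by rewrite exprn_gt0.
have [v [tv uv dv]] := dense _ d2.
have [Lv Ldv] := test_function_L2 tv.
have h1 := wnrm2_le Lu Lv.
have h2 := wnrm2_test delta0 tv.
have h3 := nrm2_le Lu Lv.
have h4 : delta^-1 * nrm2 (cpartial 0 v) <= delta.
  by rewrite ler_pdivrMl// -expr2 ltW.
have h5 : delta * nrm2 v <= delta * (2 * nrm2 u + 2 * delta ^+ 2).
  rewrite ler_wpM2l ?ltW//; lra.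
have h6 : delta ^+ 2 <= delta by rewrite expr2 ler_piMl// ltW.
have h7 : delta * delta ^+ 2 <= delta by rewrite ler_piMr ?(ltW delta0)// expr_le1// ltW.
nra.
Qed.
End Final.

(** * Eigenfunctions vanish *)

Section Virial.
Variable R : realType.
Local Notation C := R[i].
Local Notation leb3 := (@leb3 R).
Local Notation k0 := ((0 : R)%R, (0 : R)%R).
Local Notation Om := (Omega k0).
Implicit Types (u v psi : pt3 R -> C) (g h : 'I_3 -> pt3 R -> C).

Let mOm : measurable Om := @measurable_Omega R.

Lemma Re_cintegral_form g h : (forall i, L2 Om (g i)) -> (forall i, L2 Om (h i)) ->
  complex.Re (cintegral Om (fun x => \sum_(i < 3) g i x * (h i x)^*%C)) =
  \sum_(i < 3) ip (g i) (h i).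
Proof.
move=> Lg Lh; have ii i := integrable_redot (Lg i) (Lh i).
have Re_add (z w : C) : complex.Re (z + w) = complex.Re z + complex.Re w.
  by case: z w => [a b] [c d].
pose i0 : 'I_3 := ord0; pose i1 : 'I_3 := lift ord0 ord0.
pose i2 : 'I_3 := lift ord0 (lift ord0 ord0).
have ReE x : complex.Re (\sum_(i < 3) g i x * (h i x)^*%C) =
    redot (g i0 x) (h i0 x) + (redot (g i1 x) (h i1 x) + redot (g i2 x) (h i2 x)).
  by rewrite !big_ord_recl big_ord0 addr0 !Re_add -!redot_conj.
rewrite !big_ord_recl big_ord0 addr0 /cintegral /=.
under eq_Rintegral do rewrite ReE.
have i12 : leb3.-integrable Om
    (EFin \o (fun x => redot (g i1 x) (h i1 x) + redot (g i2 x) (h i2 x))).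
  have := integrable_lincomb 1 1 (ii i1) (ii i2).
  by under [X in integrable _ _ (_ \o X)]eq_fun do rewrite !mul1r.
rewrite RintegralD; [|exact: mOm|exact: ii|exact: i12].
by rewrite RintegralD; [|exact: mOm|exact: ii|exact: ii].
Qed.

Lemma Re_cintegral_scale (l : R) u psi : L2 Om u -> L2 Om psi ->
  complex.Re (cintegral Om (fun x => Complex l 0 * u x * (psi x)^*%C)) = l * ip u psi.
Proof.
move=> Lu Lpsi; rewrite /cintegral /=.
under eq_Rintegral do rewrite -mulrA Re_scale -redot_conj.
by rewrite RintegralZl//; exact: integrable_redot.
Qed.

(** The form takes real values on the diagonal, which forces eigenvalues to be
    real. *)
Lemma Im_form_self g : complex.Im (cintegral Om (fun x => \sum_(i < 3) g i x * (g i x)^*%C)) = 0.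
Proof.
have ImE x : complex.Im (\sum_(i < 3) g i x * (g i x)^*%C) = 0.
  have self (z : C) : z * z^*%C = Complex (sqmod z) 0.
    case: z => a b; apply/eqP; rewrite eq_complex /sqmod/=.
    by apply/andP; split; apply/eqP; ring.
  by rewrite !big_ord_recl big_ord0 !self /= !addr0.
rewrite /cintegral /=; under eq_Rintegral do rewrite ImE.
by rewrite Rintegral_cst// mul0r.
Qed.

Lemma Im_eigen_self (lambda : C) u : L2 Om u ->
  complex.Im (cintegral Om (fun x => lambda * u x * (u x)^*%C)) = complex.Im lambda * nrm2 u.
Proof.
move=> Lu; have ImE x : complex.Im (lambda * u x * (u x)^*%C) = complex.Im lambda * sqmod (u x).
  by case: lambda (u x) => [a b] [c d]; rewrite /sqmod/=; ring.
rewrite /cintegral /=; under eq_Rintegral do rewrite ImE.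
by rewrite RintegralZl//; exact: integrable_sqmod.
Qed.

(** The weak equation tested with the dilates of u by t and by t^-1: after a
    change of variables the two identities differ only in the term of the
    x1-derivative, which has the factor t in one and t^-1 in the other. *)
Lemma ip_dilate_partial0 (l : R) u g : H10_grad k0 u g ->
  (forall psi h, H10_grad k0 psi h -> \sum_(i < 3) ip (g i) (h i) = l * ip u psi) ->
  forall t : R, 1 < t -> ip (g 0) (g 0 \o dilate t) = 0.
Proof.
move=> Hu weak t t1; have t0 : 0 < t by exact: lt_trans t1.
have tV0 : 0 < t^-1 by rewrite invr_gt0.
have [[Lu Lg _] _] := Hu.
have := weak _ _ (H10_grad_dilate tV0 Hu); have := weak _ _ (H10_grad_dilate t0 Hu).
rewrite !big_ord_recl !big_ord0 !addr0 /dilate_grad.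
rewrite !ip_scale//; try exact: (L2_dilate _ (Lg _)).
rewrite !(ip_dilateV t0)// /dil_factor /= !mul1r.
set p0 := ip _ _; set p1 := ip _ _; set p2 := ip _ _; set q := ip _ _ => e1 e2.
have {}e2 : p0 + t * p1 + t * p2 = l * (t * q).
  by rewrite -e2 mulrA mulVf ?gt_eqF// mul1r addrA.
have e3 : (t ^+ 2 - 1) * p0 = 0 by rewrite expr2; nra.
move/eqP: e3; rewrite mulf_eq0 => /orP[/eqP t2|/eqP //].
by exfalso; nra.
Qed.

(** Unless the norm of u is 0, comparing imaginary parts in the equation tested with
    u shows that the eigenvalue is real; from then on the real inner product
    suffices. *)
Lemma eigenfunction_eq0 (lambda : C) u :
  A_graph k0 u (fun x => lambda * u x) -> ae_eq_on Om u (fun=> 0).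
Proof.
move=> [_ [g Hu weak]]; have [[Lu Lg _] tr] := Hu.
have im0 : complex.Im lambda * nrm2 u = 0.
  by rewrite -Im_eigen_self// -(weak _ _ Hu) Im_form_self.
have [nu0|nu] := eqVneq (nrm2 u) 0.
  apply: (@ae_eq0_of_weighted R (fun=> 1) u) => //.
  - exact: L2_cmeasurable.
  - by under eq_integral do rewrite mul1r; rewrite -sqnormE sqnorm_nrm2// nu0.
have {im0} lreal : lambda = Complex (complex.Re lambda) 0.
  move/eqP: im0; rewrite mulf_eq0 (negPf nu) orbF.
  by case: (lambda) => a b /= /eqP ->.
have orth := @ip_dilate_partial0 (complex.Re lambda) u g Hu.
have {}orth t : 1 < t -> ip (g 0) (g 0 \o dilate t) = 0.
  apply: orth => psi h Hpsi; have [[Lpsi Lh _] _] := Hpsi.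
  by rewrite -Re_cintegral_form// (weak psi h Hpsi) lreal Re_cintegral_scale.
(* Test functions that witness the zero trace approximate u and g together. *)
have approx eps : 0 < eps -> exists v, [/\ test_function setT v,
    nrm2 (fun x => u x - v x) < eps & nrm2 (fun x => g 0 x - cpartial 0 v x) < eps].
  move=> eps0; have [v [tv vlt _]] := tr eps eps0.
  have [Lv Ldv] := test_function_L2 tv.
  have sq0 (w : pt3 R -> C) : (0 <= sqnorm Om w)%E.
    by apply: integral_ge0 => x _; rewrite lee_fin sqr_ge0.
  exists v; split => //.
    rewrite -lte_fin -sqnorm_nrm2; last exact: L2_sub.
    by apply: le_lt_trans vlt; rewrite leeDl// sume_ge0.
  rewrite -lte_fin -sqnorm_nrm2; last exact: L2_sub.
  apply: le_lt_trans vlt; rewrite big_ord_recl.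
  by rewrite addeA addeAC leeDr// adde_ge0// sume_ge0.
have g00 : nrm2 (g 0) = 0.
  apply: dilation_orthogonal_eq0 => // eps eps0.
  have [v [tv _ vlt]] := approx _ eps0.
  have [K [cK _ _ _ vP]] := test_function_support tv.
  have [_ _ cPR cPI] := test_function_continuous tv.
  by exists (cpartial 0 v), K; have [? ?] := vP 0; split.
apply: ae_eq0_of_partial0 => // eps eps0.
have eps2 : 0 < eps / 2 by rewrite divr_gt0.
have [v [tv uv dv]] := approx _ eps2.
have [Lv Ldv] := test_function_L2 tv.
exists v; split => //; first lra.
by have := nrm2_le (Lg 0) (Ldv 0); rewrite g00; lra.
Qed.
End Virial.

Theorem theorem3p1 (R : realType) (kappa : R * R)
    (hkappa : kappa = (0%R, 0%R)) :
  sigma_d kappa = classical_sets.set0.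
Proof.
rewrite hkappa; apply/seteqP; split => // lambda [[u [Au une0]] _ _].
by case: une0; exact: eigenfunction_eq0 Au.
Qed.
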